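(* Let $-1<q<1$, and for $k\in\mathbb N$, $k\ge1$, let $\Gamma_k=\Gamma(k,|q|)$ be the Erdős–Rényi graph on $k$ vertices with edge probability $|q|$. Put $x^{q,\Gamma_k}_v=x^{\Gamma_k}_v$ if $q\ge0$ and $x^{q,\Gamma_k}_v=x^{\Gamma_k,\mathrm{Cl}}_v$ if $q<0$. Then for every $\alpha\in(\tfrac12,1)$ there exist constants $C_q,c_q>0$ such that for every $k$ $$\mathbb P\left(\Bigl\|\frac1{\sqrt k}\sum_{v\in\Gamma_k}x_v^{q,\Gamma_k}\Bigr\|\le\frac2{\sqrt{1-q}}+C_qk^{\alpha-1}\log k\right)\ge1-\exp(-c_q\log^2k)-2k\exp(-c_qk^{2\alpha-1}).$$ Consequently, for every fixed $\varepsilon>0$ there is a constant $c_{q,\varepsilon}>0$ such that for all large $k$ $$\mathbb P\left(\Bigl\|\frac1{\sqrt k}\sum_{v\in\Gamma_k}x_v^{q,\Gamma_k}\Bigr\|\le\frac2{\sqrt{1-q}}+\varepsilon\right)\ge1-\exp(-c_{q,\varepsilon}\log^2k)-2k\exp\Bigl(-c_{q,\varepsilon}\frac{k}{(\log k)^2}\Bigr).$$ Moreover, in probability, $$\Bigl\|\frac1{\sqrt k}\sum_{v\in\Gamma_k}x_v^{q,\Gamma_k}\Bigr\|\le\frac2{\sqrt{1-q}}+\mathcal O\Bigl(\frac{\log k}{\sqrt k}\Bigr),$$ i.e. the positive part of the difference between the left-hand side and $2/\sqrt{1-q}$ is $\mathcal O_{\mathbb P}(\log k/\sqrt k)$ (its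 quotient by $\log k/\sqrt k$ is bounded in probability).
   Context: $\Gamma(k,p)$ is the random graph on $k$ vertices in which edges occur independently with probability $p$. For a finite simple graph $\Gamma$, $\mathcal A_\Gamma^+$ is the right-angled Artin monoid generated by the vertices of $\Gamma$ subject to $uv=vu$ whenever $u,v$ are adjacent; $\mathcal F_\Gamma=\ell^2(\mathcal A_\Gamma^+)$ with orthonormal basis $(\delta_w)$; $\ell_v\delta_w=\delta_{vw}$ is the left creation operator; $x^\Gamma_v=\ell_v+\ell_v^*$ (graph-product semicircular variables). $\mathrm{Cliff}(\Gamma)$ is the algebra generated by self-adjoint unitaries $c_v$, $v\in\Gamma$, with $c_uc_v=-c_vc_u$ for $u\ne v$, with canonical trace $\tau_{\rm Cl}$ (zero on nontrivial reduced words), acting on $L^2(\mathrm{Cliff}(\Gamma),\tau_{\rm Cl})$. Put $\widetilde\ell_v=c_v\otimes\ell_v$ on $L^2(\mathrm{Cliff}(\Gamma),\tau_{\rm Cl})\otimes\mathcal F_\Gamma$ and $x_v^{\Gamma,\mathrm{Cl}}=\widetilde\ell_v+\widetilde\ell_v^*$. *)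

(* Defs.v *)
From HB Require Import structures.
From mathcomp Require Import all_boot all_order all_algebra.
From mathcomp Require Import complex.
From mathcomp Require Import all_classical all_reals all_analysis.
From mathcomp Require Import generic_quotient.
From mathcomp Require Import ring.

Set Implicit Arguments.
Unset Strict Implicit.
Unset Printing Implicit Defensive.

Import Order.TTheory GRing.Theory Num.Theory.

Local Open Scope quotient_scope.
Local Open Scope classical_set_scope.
Local Open Scope ring_scope.
Local Open Scope complex_scope.

Definition edge (k : nat) := {e : {set 'I_k} | #|e| == 2%N}.

Definition graph (k : nat) := {set edge k}.

Definition edge_rel (k : nat) (G : graph k) : rel 'I_k :=
  fun u v => [exists e in G, val e == [set u; v]%SET].

(* Product law: edges are present independently with probability p. *)
Definition er_weight (R : realType) (k : nat) (p : R) (G : graph k) : R :=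
  \prod_(e : edge k) (if e \in G then p else 1 - p).

Definition er_prob (R : realType) (k : nat) (p : R) (A : pred (graph k)) : R :=
  \sum_(G : graph k | A G) er_weight p G.

Lemma edge_rel_sym k (G : graph k) : symmetric (edge_rel G).
Proof.
by move=> u v; rewrite /edge_rel; apply/existsP/existsP => -[e] /andP[eG /eqP ev];
  exists e; rewrite eG ev finset.setUC eqxx.
Qed.

Lemma edge_rel_irr k (G : graph k) : irreflexive (edge_rel G).
Proof.
move=> u; rewrite /edge_rel; apply/negbTE/negP => /existsP[e /andP[_ /eqP eu]].
by have := valP e; rewrite /= eu finset.setUid cards1.
Qed.

Lemma er_prob_supset (R : realType) k (p : R) (S : {set edge k}) :
  er_prob p (fun G : graph k => S \subset G) = p ^+ #|S|.
Proof.
rewrite /er_prob /er_weight.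
pose F (e : edge k) (b : bool) : R :=
  if b then p else if e \in S then 0 else 1 - p.
transitivity (\prod_(e : edge k) \sum_(b : bool) F e b).
  rewrite bigA_distr_bigA /= (reindex (fun f : {ffun edge k -> bool} =>
     [set e | f e]%SET)) /=; last first.
    exists (fun G : {set edge k} => [ffun e => e \in G]) => [f _|G _].
      by apply/ffunP => e; rewrite ffunE inE.
    by apply/setP => e; rewrite inE ffunE.
  rewrite big_mkcond /=; apply: eq_bigr => f _.
  case: ifPn => [/fintype.subsetP Sf | /subsetPn[e eS]].
    apply: eq_bigr => e _; rewrite inE /F.
    case: ifPn => // fe; case: ifPn => // /Sf; by rewrite inE (negbTE fe).
  rewrite inE => /negbTE fe.
  by rewrite (bigD1 e) //= /F fe eS mul0r.
rewrite (eq_bigr (fun e => if e \in S then p else 1)); last first.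
  move=> e _; rewrite big_bool /F /=; case: ifP => _; first by rewrite addr0.
  by rewrite addrC subrK.
by rewrite -big_mkcond /= prodr_const.
Qed.

Lemma er_probT (R : realType) k (p : R) : er_prob p (fun _ : graph k => true) = 1.
Proof.
have <- : er_prob p (fun G : graph k => finset.set0 \subset G) = 1.
  by rewrite er_prob_supset cards0 expr0.
by rewrite /er_prob; apply: eq_bigl => G; rewrite finset.sub0set.
Qed.

Inductive trace_cong (V : Type) (e : rel V) : seq V -> seq V -> Prop :=
| trace_refl s : trace_cong e s s
| trace_sym s t : trace_cong e s t -> trace_cong e t s
| trace_trans t s r : trace_cong e s t -> trace_cong e t r -> trace_cong e s r
| trace_swap s t u v :
    e u v -> trace_cong e (s ++ [:: u, v & t]) (s ++ [:: v, u & t]).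

Definition trace_eqb (V : finType) (e : rel V) : rel (seq V) :=
  fun s t => `[< trace_cong e s t >].

Lemma trace_eqb_equiv (V : finType) (e : rel V) : equiv_class_of (trace_eqb e).
Proof.
split.
- by move=> s; apply/asboolP; exact: trace_refl.
- by move=> s t; apply/asboolP/asboolP => /trace_sym.
- move=> t s r /asboolP st /asboolP tr; apply/asboolP.
  exact: trace_trans st tr.
Qed.

Canonical trace_equiv (V : finType) (e : rel V) :=
  EquivRelPack (trace_eqb_equiv e).

Definition raam (V : finType) (e : rel V) := {eq_quot (trace_equiv e)}.
HB.instance Definition _ (V : finType) (e : rel V) :=
  Choice.on (raam e).
HB.instance Definition _ (V : finType) (e : rel V) := EqQuotient.on (raam e).

Lemma trace_cat (V : Type) (e : rel V) s s' t t' :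
  trace_cong e s s' -> trace_cong e t t' -> trace_cong e (s ++ t) (s' ++ t').
Proof.
move=> ss' tt'; apply: (@trace_trans _ _ (s' ++ t)).
  elim: ss' => {s s'} [s|s r _ IH|s r q _ IH1 _ IH2|s r u v uv].
  - exact: trace_refl.
  - exact: trace_sym.
  - exact: trace_trans IH1 IH2.
  - by rewrite -!catA /=; exact: trace_swap.
elim: tt' => {t t'} [t|t r _ IH|t r q _ IH1 _ IH2|t r u v uv].
- exact: trace_refl.
- exact: trace_sym.
- exact: trace_trans IH1 IH2.
- by rewrite !catA; exact: trace_swap.
Qed.

Section RaamMonoid.
Context (V : finType) (e : rel V).

Lemma raam_piP (s t : seq V) :
  \pi_(raam e) s = \pi_(raam e) t <-> trace_cong e s t.
Proof.
split=> [/eqP|st]; first by rewrite eqmodE => /asboolP.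
by apply/eqP; rewrite eqmodE; apply/asboolP.
Qed.

Definition raam_one : raam e := \pi_(raam e) [::].
Definition raam_mul (w w' : raam e) : raam e := \pi_(raam e) (repr w ++ repr w').

Lemma trace_repr (s : seq V) : trace_cong e (repr (\pi_(raam e) s)) s.
Proof. by apply/raam_piP; rewrite reprK. Qed.

Lemma raam_mul_pi (s t : seq V) :
  raam_mul (\pi_(raam e) s) (\pi_(raam e) t) = \pi_(raam e) (s ++ t).
Proof. by apply/raam_piP; apply: trace_cat; exact: trace_repr. Qed.

Lemma raam_repr (w : raam e) : exists s, w = \pi_(raam e) s.
Proof. by exists (repr w); rewrite reprK. Qed.

Lemma raam_mulA : associative raam_mul.
Proof.
move=> x y z; have [s ->] := raam_repr x; have [t ->] := raam_repr y.
have [r ->] := raam_repr z.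
by rewrite (raam_mul_pi t r) (raam_mul_pi s t) !raam_mul_pi catA.
Qed.

Lemma raam_mul1g : left_id raam_one raam_mul.
Proof. by move=> x; have [s ->] := raam_repr x; rewrite raam_mul_pi. Qed.

Lemma raam_mulg1 : right_id raam_one raam_mul.
Proof. by move=> x; have [s ->] := raam_repr x; rewrite raam_mul_pi cats0. Qed.

HB.instance Definition _ :=
  isMonoid.Build (raam e) raam_mulA raam_mul1g raam_mulg1.

Definition raam_gen (v : V) : raam e := \pi_(raam e) [:: v].

Lemma raam_gen_mul v s :
  (raam_gen v * \pi_(raam e) s)%g = \pi_(raam e) (v :: s).
Proof. exact: (raam_mul_pi [:: v] s). Qed.

Lemma raam_genC u v : e u v ->
  (raam_gen u * raam_gen v = raam_gen v * raam_gen u)%g.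
Proof.
move=> uv; rewrite [LHS]raam_mul_pi [RHS]raam_mul_pi.
by apply/raam_piP; exact: (@trace_swap _ e [::] [::]).
Qed.

Lemma trace_rem v s t : trace_cong e s t -> trace_cong e (rem v s) (rem v t).
Proof.
elim=> {s t} [s|s r _ IH|s r q _ IH1 _ IH2|s r a b ab].
- exact: trace_refl.
- exact: trace_sym.
- exact: trace_trans IH1 IH2.
- elim: s => [|c s IH] /=.
    case: eqP => [av|_]; case: eqP => [bv|_]; rewrite ?av ?bv;
      try exact: trace_refl.
    exact: (@trace_swap _ e [::]).
  case: eqP => _; first exact: trace_swap.
  exact: (@trace_cat _ e [:: c] [:: c] _ _ (trace_refl _ _)).
Qed.

Lemma raam_gen_inj v : injective (fun w : raam e => raam_gen v * w)%g.
Proof.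
move=> w w'; have [s ->] := raam_repr w; have [t ->] := raam_repr w'.
rewrite !raam_gen_mul => /raam_piP /(@trace_rem v) /=.
by rewrite eqxx => /raam_piP.
Qed.

End RaamMonoid.

(* Vectors are arbitrary functions I -> R[i]; l^2(I) consists of those with
   finite l2norm.  Operators are total maps on I -> R[i] that are meant to be
   bounded on l^2(I). *)

Section RealSum.
Context (R : realType).

Definition rsum (I : choiceType) (f : I -> R) : R :=
  fine (\esum_(i in [set: I]) (Num.max (f i) 0)%:E) -
  fine (\esum_(i in [set: I]) (Num.max (- f i) 0)%:E).

(* The sum of an absolutely summable complex family. *)
Definition csum (I : choiceType) (f : I -> R[i]) : R[i] :=
  rsum (fun i => complex.Re (f i)) +i* rsum (fun i => complex.Im (f i)).

Lemma esum_inj (I J : choiceType) (g : I -> J) (f : J -> \bar R) :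
  injective g -> (forall j, ~ range g j -> f j = 0%E) ->
  \esum_(j in [set: J]) f j = \esum_(i in [set: I]) f (g i).
Proof.
move=> ginj f0.
transitivity (\esum_(j in range g) f j); last first.
  by apply: esum_image => x y _ _; exact: ginj.
rewrite [RHS]esum_mkcond; apply: eq_esum => j _.
by case: ifPn => //; rewrite notin_setE; exact: f0.
Qed.

Lemma rsum_inj (I J : choiceType) (g : I -> J) (f : J -> R) :
  injective g -> (forall j, ~ range g j -> f j = 0) ->
  rsum f = rsum (f \o g).
Proof.
move=> ginj f0; rewrite /rsum; congr (fine _ - fine _).
  by apply: esum_inj => // j /f0 ->; rewrite maxxx.
by apply: esum_inj => // j /f0 ->; rewrite oppr0 maxxx.
Qed.

Lemma csum_inj (I J : choiceType) (g : I -> J) (f : J -> R[i]) :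
  injective g -> (forall j, ~ range g j -> f j = 0) ->
  csum f = csum (f \o g).
Proof.
move=> ginj f0; rewrite /csum; congr (_ +i* _).
  by rewrite (rsum_inj ginj) // => j /f0 ->.
by rewrite (rsum_inj ginj) // => j /f0 ->.
Qed.

Lemma rsum_unit (f : unit -> R) : rsum f = f tt.
Proof.
rewrite /rsum; have -> : [set: unit] = [set tt] by apply/seteqP; split=> -[].
rewrite !esum_set1 ?lee_fin ?le_max ?lexx ?orbT //=.
have /orP[h|h] := le_total 0 (f tt).
  by rewrite max_l // max_r ?subr0 // oppr_le0.
by rewrite max_r // max_l ?oppr_ge0 // sub0r opprK.
Qed.

Lemma csum_supp1 (I : choiceType) (i : I) (f : I -> R[i]) :
  (forall j, j != i -> f j = 0) -> csum f = f i.
Proof.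
move=> f0; rewrite (csum_inj (g := fun _ : unit => i)).
- by rewrite /csum !rsum_unit /=; case: (f i).
- by move=> [] [].
- move=> j nj; apply: f0; apply/eqP => ji; apply: nj; exists tt => //.
Qed.

End RealSum.

Section Hilbert.
Context (R : realType) (I : choiceType).

Definition l2norm (xi : I -> R[i]) : \bar R :=
  sqrte (\esum_(i in [set: I])
           (complex.Re (xi i) ^+ 2 + complex.Im (xi i) ^+ 2)%:E).

Definition dot (xi eta : I -> R[i]) : R[i] := csum (fun i => xi i * (eta i)^*).

Definition delta (i : I) : I -> R[i] := fun j => (j == i)%:R.

Definition op := (I -> R[i]) -> (I -> R[i]).

(* <T^* eta, delta_i> = <eta, T delta_i> *)
Definition adj (T : op) : op := fun eta i => dot eta (T (delta i)).

Definition opnorm (T : op) : \bar R :=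
  ereal_sup [set l2norm (T xi) | xi in [set xi | (l2norm xi <= 1)%E]].

End Hilbert.

(* S (x) T = (S (x) 1)(1 (x) T) on l^2(I) (x) l^2(J) = l^2(I * J). *)
Definition tens (R : realType) (I J : choiceType) (S : op R I) (T : op R J) :
    op R (I * J)%type :=
  fun xi p => S (fun i => T (fun j => xi (i, j)) p.2) p.1.

Section Creation.
Context (R : realType) (V : finType) (e : rel V).

(* Linear extension of delta_u |-> delta_(v u); by left cancellation the sum
   has at most one term. *)
Definition creation (v : V) : op R (raam e) :=
  fun xi w => \sum_(u \in [set u | (raam_gen e v * u)%g = w]) xi u.

Lemma creation_gen v xi u : creation v xi (raam_gen e v * u)%g = xi u.
Proof.
rewrite /creation (_ : [set u0 | _] = [set u]) ?fsbig_set1 //.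
by apply/seteqP; split=> [u' /= /raam_gen_inj //|u' /= ->].
Qed.

Lemma creation_out v xi w :
  ~ range (fun u => raam_gen e v * u)%g w -> creation v xi w = 0.
Proof.
move=> nw; rewrite /creation (_ : [set u0 | _] = set0) ?fsbig_set0 //.
by apply/seteqP; split=> // u' /= uw; apply: nw; exists u'.
Qed.

Lemma creation_delta v u :
  creation v (delta R u) = delta R (raam_gen e v * u)%g.
Proof.
apply/funext => w; have [[u' _ <-]|nw] := pselect (range (fun u => raam_gen e v * u)%g w).
  by rewrite creation_gen /delta (inj_eq (@raam_gen_inj _ _ v)).
rewrite creation_out // /delta; case: eqP => // wu.
by case: nw; exists u.
Qed.

Lemma l2norm_creation v xi : l2norm (creation v xi) = l2norm xi.
Proof.
rewrite /l2norm (esum_inj (@raam_gen_inj _ e v)).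
  by under eq_esum do rewrite creation_gen.
by move=> w nw; rewrite creation_out //= expr0n addr0.
Qed.

Lemma adj_creation v eta w : adj (creation v) eta w = eta (raam_gen e v * w)%g.
Proof.
rewrite /adj creation_delta /dot (csum_supp1 (i := (raam_gen e v * w)%g)).
  by rewrite /delta eqxx conjC1 mulr1.
by move=> w' /negbTE ww'; rewrite /delta ww' conjC0 mulr0.
Qed.

Lemma dot_creation v xi eta :
  dot (creation v xi) eta = dot xi (adj (creation v) eta).
Proof.
rewrite /dot (csum_inj (@raam_gen_inj _ e v)).
  by congr csum; apply/funext => u /=; rewrite creation_gen adj_creation.
by move=> w nw; rewrite creation_out // mul0r.
Qed.

End Creation.

(* Cliff has linear basis c_S = c_(s_1) ... c_(s_m), S = {s_1 < ... < s_m};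
   symd_sign S T is the sign in c_S c_T = +- c_(symd S T), one factor -1 per
   transposition of anticommuting generators. *)

Section Clifford.
Context (R : realType) (k : nat).
Local Notation C := R[i].
Implicit Types (S T U : {set 'I_k}).

Definition symd S T : {set 'I_k} := (S :\: T) :|: (T :\: S).

Definition symd_sign S T : C :=
  \prod_(s in S) \prod_(t in T) (if (t < s)%N then -1 else 1).

Definition cliff := {set 'I_k} -> C.

Definition cliff_mul (x y : cliff) : cliff := fun U =>
  \sum_(S : {set 'I_k}) \sum_(T : {set 'I_k} | symd S T == U)
    symd_sign S T * x S * y T.

Definition cliff_one : cliff := delta R finset.set0.

Definition cliff_gen (v : 'I_k) : cliff := delta R (finset.set1 v).

Definition cliff_star (x : cliff) : cliff := fun S => symd_sign S S * (x S)^*.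

Definition cliff_trace (x : cliff) : C := x finset.set0.

Lemma in_symd S T v : (v \in symd S T) = (v \in S) (+) (v \in T).
Proof. by rewrite !inE; case: (v \in S); case: (v \in T). Qed.

Lemma symdC S T : symd S T = symd T S.
Proof. by apply/setP => v; rewrite !in_symd addbC. Qed.

Lemma symdA S T U : symd S (symd T U) = symd (symd S T) U.
Proof. by apply/setP => v; rewrite !in_symd addbA. Qed.

Lemma symd0 S : symd S finset.set0 = S.
Proof. by apply/setP => v; rewrite in_symd inE addbF. Qed.

Lemma symdd S : symd S S = finset.set0.
Proof. by apply/setP => v; rewrite in_symd inE addbb. Qed.

Lemma symdK S T : symd S (symd S T) = T.
Proof. by rewrite symdA symdd symdC symd0. Qed.

Lemma symd_eq S T U : (symd S T == U) = (T == symd S U).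
Proof. by apply/eqP/eqP => [<-|->]; rewrite symdK. Qed.

Lemma prod_symd (f : 'I_k -> C) S T : (forall v, f v * f v = 1) ->
  \prod_(v in symd S T) f v = (\prod_(v in S) f v) * (\prod_(v in T) f v).
Proof.
move=> f2; rewrite big_mkcond /= [X in X * _]big_mkcond [X in _ * X]big_mkcond /=.
rewrite -big_split /=; apply: eq_bigr => v _; rewrite in_symd.
by case: (v \in S); case: (v \in T); rewrite /= ?mulr1 ?mul1r ?f2.
Qed.

Lemma symd_sign_sym S S' T :
  symd_sign (symd S S') T = symd_sign S T * symd_sign S' T.
Proof.
apply: prod_symd => v; rewrite -big_split big1 //= => t _.
by case: ifP => _; rewrite ?mulrNN mulr1.
Qed.

Lemma symd_sign_symr S T T' :
  symd_sign S (symd T T') = symd_sign S T * symd_sign S T'.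
Proof.
rewrite /symd_sign -big_split; apply: eq_bigr => v _; apply: prod_symd => t.
by case: ifP => _; rewrite ?mulrNN mulr1.
Qed.

Lemma symd_sign2 S T : symd_sign S T * symd_sign S T = 1.
Proof.
rewrite -symd_sign_sym symdd /symd_sign.
by rewrite big1 // => v; rewrite inE.
Qed.

Lemma cliff_mulE (x y : cliff) U : cliff_mul x y U =
  \sum_S symd_sign S (symd S U) * x S * y (symd S U).
Proof.
apply: eq_bigr => S _; rewrite (bigD1 (symd S U)) /= ?symdK ?eqxx //.
rewrite big1 ?addr0 // => T; rewrite symd_eq => /andP[/eqP ->].
by rewrite eqxx.
Qed.

Lemma cliff_mulA : associative cliff_mul.
Proof.
move=> x y z; apply/funext => U; rewrite !cliff_mulE.
under eq_bigr => S _ do rewrite cliff_mulE mulr_sumr.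
under [RHS]eq_bigr => S _ do rewrite cliff_mulE mulr_sumr mulr_suml.
rewrite [RHS]exchange_big /=; apply: eq_bigr => S _.
rewrite [RHS](reindex_inj (h := symd S)) /=; last first.
  by move=> T T' /(congr1 (symd S)); rewrite !symdK.
apply: eq_bigr => T _.
rewrite symdK -symdA.
have -> : symd S (symd T U) = symd T (symd S U).
  by rewrite symdA [symd S T]symdC -symdA.
set A := symd T _.
have -> : symd S U = symd T A by rewrite /A symdK.
rewrite symd_sign_symr symd_sign_sym; ring.
Qed.

Lemma cliff_mul_delta S T :
  cliff_mul (delta R S) (delta R T) =
  (fun U => symd_sign S T * delta R (symd S T) U).
Proof.
apply/funext => U; rewrite cliff_mulE (bigD1 S) //= big1 ?addr0; last first.
  by move=> S' /negbTE SS'; rewrite /delta SS' mulr0 mul0r.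
rewrite /delta eqxx mulr1 [U == _]eq_sym symd_eq [symd S U == T]eq_sym.
by case: eqP => [->|_]; rewrite ?mulr0.
Qed.

Lemma symd_sign0 S : symd_sign finset.set0 S = 1.
Proof. by rewrite /symd_sign big1 // => v; rewrite inE. Qed.

Lemma symd_sign0r S : symd_sign S finset.set0 = 1.
Proof. by rewrite /symd_sign big1 // => v _; rewrite big1 // => t; rewrite inE. Qed.

Lemma cliff_mul1 : left_id cliff_one cliff_mul.
Proof.
move=> x; apply/funext => U; rewrite cliff_mulE (bigD1 finset.set0) //= big1 ?addr0.
  by rewrite symd_sign0 symdC symd0 /cliff_one /delta eqxx !mul1r.
by move=> S /negbTE S0; rewrite /cliff_one /delta S0 mulr0 mul0r.
Qed.

Lemma cliff_mulr1 : right_id cliff_one cliff_mul.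
Proof.
move=> x; apply/funext => U; rewrite cliff_mulE (bigD1 U) //= big1 ?addr0.
  by rewrite symdd symd_sign0r /cliff_one /delta eqxx mulr1 mul1r.
move=> S SU; rewrite /cliff_one /delta symd_eq symd0 eq_sym.
by rewrite (negbTE SU) mulr0.
Qed.

Lemma symd_sign1 u v :
  symd_sign (finset.set1 u) (finset.set1 v) = if (v < u)%N then -1 else 1.
Proof. by rewrite /symd_sign !big_set1. Qed.

Lemma cliff_gen_sq v : cliff_mul (cliff_gen v) (cliff_gen v) = cliff_one.
Proof.
apply/funext => U; rewrite cliff_mul_delta symd_sign1 ltnn mul1r symdd.
by [].
Qed.

Lemma cliff_gen_anti u v : u != v ->
  cliff_mul (cliff_gen u) (cliff_gen v) =
  (fun S => - cliff_mul (cliff_gen v) (cliff_gen u) S).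
Proof.
move=> uv; rewrite !cliff_mul_delta; apply/funext => S.
rewrite !symd_sign1 [symd (finset.set1 v) _]symdC.
by case: (ltngtP u v) => [||/val_inj /eqP]; rewrite ?(negbTE uv) // ?mulN1r ?mul1r ?opprK.
Qed.

Lemma cliff_gen_star v : cliff_star (cliff_gen v) = cliff_gen v.
Proof.
apply/funext => S; rewrite /cliff_star /cliff_gen /delta.
case: eqP => [->|_]; last by rewrite conjC0 mulr0.
by rewrite symd_sign1 ltnn conjC1 mul1r.
Qed.

Lemma conj_symd_sign S T : Num.conj (symd_sign S T) = symd_sign S T.
Proof.
rewrite /symd_sign rmorph_prod; apply: eq_bigr => s _.
rewrite rmorph_prod; apply: eq_bigr => t _.
by case: ifP => _; rewrite ?rmorphN rmorph1.
Qed.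

Lemma conj_mulc (a b : C) : Num.conj (a * b) = Num.conj a * Num.conj b.
Proof. exact: rmorphM. Qed.

Lemma cliff_starK : involutive cliff_star.
Proof.
move=> x; apply/funext => S; rewrite /cliff_star conj_mulc conj_symd_sign.
by rewrite conjCK mulrA symd_sign2 mul1r.
Qed.

Lemma cliff_star_mul x y :
  cliff_star (cliff_mul x y) = cliff_mul (cliff_star y) (cliff_star x).
Proof.
apply/funext => U; rewrite /cliff_star !cliff_mulE rmorph_sum mulr_sumr /=.
rewrite [RHS](reindex_inj (h := symd U)) /=; last first.
  by move=> T T' /(congr1 (symd U)); rewrite !symdK.
apply: eq_bigr => S _; rewrite [symd U S]symdC.
have -> : symd (symd S U) U = S by rewrite -symdA symdd symd0.
rewrite !conj_mulc conj_symd_sign.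
have := symdK S U; move: (symd S U) => T <-.
rewrite symd_sign_sym !symd_sign_symr.
have e1 := symd_sign2 S T.
transitivity ((symd_sign S T * symd_sign S T) *
  (symd_sign S S * symd_sign T S * symd_sign T T * (x S)^* * (y T)^*)).
  ring.
rewrite e1; ring.
Qed.

Lemma cliff_word (s : seq 'I_k) : sorted (fun u v : 'I_k => (u < v)%N) s ->
  foldr (fun v => cliff_mul (cliff_gen v)) cliff_one s =
  delta R (finset.finset (fun v => v \in s)).
Proof.
elim: s => [|v s IH] /= vs.
  by congr delta; apply/setP => v; rewrite !inE.
have lt_trans : transitive (fun u v : 'I_k => (u < v)%N).
  by move=> a b c; exact: ltn_trans.
rewrite IH ?(path_sorted vs) // cliff_mul_delta; apply/funext => U.
have /allP vlt := order_path_min lt_trans vs.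
rewrite /symd_sign big_set1 big1 ?mul1r; last first.
  by move=> t; rewrite inE => /vlt; case: ltngtP.
congr delta; apply/setP => u; rewrite in_symd !inE.
by case: eqVneq => [->|//]; case: (boolP (v \in s)) => // /vlt; rewrite ltnn.
Qed.

Lemma cliff_trace_word (s : seq 'I_k) : sorted (fun u v : 'I_k => (u < v)%N) s ->
  cliff_trace (foldr (fun v => cliff_mul (cliff_gen v)) cliff_one s) =
  (s == [::])%:R.
Proof.
move=> ss; rewrite cliff_word // /cliff_trace /delta; congr (nat_of_bool _)%:R.
case: s {ss} => [|v s].
  by apply/eqP/setP => v; rewrite !inE.
by apply/negbTE/eqP => /setP/(_ v); rewrite !inE eqxx.
Qed.

(* L^2(Cliff, cliff_trace) is l^2 of the basis (c_S). *)
Lemma cliff_inner (x y : cliff) :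
  cliff_trace (cliff_mul (cliff_star y) x) = \sum_S x S * (y S)^*.
Proof.
rewrite /cliff_trace cliff_mulE; apply: eq_bigr => S _.
by rewrite symd0 /cliff_star mulrA symd_sign2 mul1r mulrC.
Qed.

Definition cliff_op (v : 'I_k) : op R {set 'I_k} := cliff_mul (cliff_gen v).

End Clifford.

Section TwistedCreation.
Context (R : realType) (k : nat) (e : rel 'I_k).
Implicit Types (v : 'I_k) (S : {set 'I_k}) (w : raam e).

Local Notation twisted v := (tens (cliff_op (R := R) v) (creation (e := e) v)).
Local Notation tgen v :=
  (fun p : {set 'I_k} * raam e =>
     (symd (finset.set1 v) p.1, (raam_gen e v * p.2)%g)).

Let tgen_inj v : injective (tgen v).
Proof.
move=> [S w] [S' w'] /= [/(congr1 (symd (finset.set1 v)))].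
by rewrite !symdK => -> /raam_gen_inj ->.
Qed.

Lemma cliff_opE v (x : {set 'I_k} -> R[i]) S :
  cliff_op v x S = symd_sign R (finset.set1 v) (symd (finset.set1 v) S) *
                   x (symd (finset.set1 v) S).
Proof.
rewrite /cliff_op cliff_mulE (bigD1 (finset.set1 v)) //= big1 ?addr0.
  by rewrite /cliff_gen /delta eqxx mulr1.
by move=> T /negbTE Tv; rewrite /cliff_gen /delta Tv mulr0 mul0r.
Qed.

Lemma twisted_gen v xi p :
  twisted v xi (tgen v p) = symd_sign R (finset.set1 v) p.1 * xi p.
Proof.
by case: p => S w; rewrite /tens cliff_opE /= symdK creation_gen.
Qed.

Lemma twisted_out v xi p : ~ range (tgen v) p -> twisted v xi p = 0.
Proof.
case: p => S w np; rewrite /tens cliff_opE /= creation_out ?mulr0 //.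
case=> w' _ /= ww'; apply: np; exists (symd (finset.set1 v) S, w') => //=.
by rewrite symdK ww'.
Qed.

Lemma twisted_delta v p :
  twisted v (delta R p) =
  (fun p' => symd_sign R (finset.set1 v) p.1 * delta R (tgen v p) p').
Proof.
apply/funext => p'.
have [[p0 _ <-]|np] := pselect (range (tgen v) p').
  rewrite twisted_gen /delta (inj_eq (@tgen_inj v)).
  by case: eqP => [->|]; rewrite ?mulr0.
rewrite twisted_out // /delta; case: eqP => [pp|_]; last by rewrite mulr0.
by case: np; exists p.
Qed.

Lemma l2norm_twisted v xi : l2norm (twisted v xi) = l2norm xi.
Proof.
rewrite /l2norm (esum_inj (@tgen_inj v)); last first.
  by move=> p np; rewrite twisted_out //= expr0n addr0.
congr sqrte; apply: eq_esum => p _; rewrite twisted_gen.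
have /eqP := symd_sign2 R (finset.set1 v) p.1.
rewrite -expr2 sqrf_eq1 => /orP[/eqP -> | /eqP ->]; first by rewrite mul1r.
by rewrite mulN1r; case: (xi p) => a b /=; rewrite !sqrrN.
Qed.

Lemma adj_twisted v eta p :
  adj (twisted v) eta p = symd_sign R (finset.set1 v) p.1 * eta (tgen v p).
Proof.
rewrite /adj twisted_delta /dot (csum_supp1 (i := tgen v p)).
  by rewrite /delta eqxx mulr1 conj_symd_sign mulrC.
by move=> p' /negbTE pp; rewrite /delta pp mulr0 conjC0 mulr0.
Qed.

Lemma dot_twisted v xi eta :
  dot (twisted v xi) eta = dot xi (adj (twisted v) eta).
Proof.
rewrite /dot (csum_inj (@tgen_inj v)).
  congr csum; apply/funext => p /=; rewrite adj_twisted conj_mulc conj_symd_sign.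
  by rewrite [twisted v xi _]twisted_gen /= mulrCA mulrA.
by move=> p np; rewrite twisted_out // mul0r.
Qed.

End TwistedCreation.

Section Semicircular.
Context (R : realType).

Definition op_self (I : choiceType) (T : op R I) : op R I :=
  fun xi i => T xi i + adj T xi i.

Definition semicirc (k : nat) (G : graph k) (v : 'I_k) :
    op R (raam (edge_rel G)) :=
  op_self (creation (e := edge_rel G) v).

Definition semicirc_cliff (k : nat) (G : graph k) (v : 'I_k) :
    op R ({set 'I_k} * raam (edge_rel G))%type :=
  op_self (tens (cliff_op v) (creation (e := edge_rel G) v)).

Arguments semicirc {k} G v.
Arguments semicirc_cliff {k} G v.

Definition normalized_sum (I : choiceType) (k : nat) (x : 'I_k -> op R I) :
    op R I :=
  fun xi i => ((Num.sqrt (k%:R : R))^-1)%:C * \sum_(v < k) x v xi i.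

Definition q_norm (q : R) (k : nat) (G : graph k) : \bar R :=
  if 0 <= q then opnorm (normalized_sum (semicirc G))
  else opnorm (normalized_sum (semicirc_cliff G)).

End Semicircular.

(* Main.v *)
(** Let [a = k^(-1/2) sum_v l_v].  Distinct creation operators satisfy
    [l_u' l_v = (+-) l_v l_u'] if [u] and [v] are adjacent and [l_u' l_v = 0]
    otherwise (['] denotes the adjoint, and the sign is that of [q]), so
    [a' a = 1 + q a a' + E], where the error [E] is, up to a sign, the form of
    the centred adjacency matrix divided by [k] and evaluated on the [l_v'].
    Since the projections [l_v l_v'] containing a given word come from a clique,
    [|E| <= (|q| + mu) omega / k], with [omega] the clique number and [mu] the
    norm of the centred adjacency matrix.  From the relation, [a + a'] is at
    most [2 / sqrt (1 - q) + O(|E|)], by [|a|^2 <= 1 + q |a|^2 + |E|] if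
    [q >= 0] and by a sum of squares if [q < 0].  Finally [omega = O(log k)]
    outside an event of probability [exp (- c log^2 k)] by the first moment
    method, and [mu = O(sqrt k)] outside an event of probability [exp (- k)] by
    a net argument. *)

Require Import Defs.
From mathcomp Require Import all_boot all_order all_algebra.
From mathcomp Require Import all_classical all_reals all_analysis.
From mathcomp Require Import finmap complex ring lra.

Set Implicit Arguments.
Unset Strict Implicit.
Unset Printing Implicit Defensive.

Import Order.TTheory GRing.Theory Num.Theory.
Local Open Scope ring_scope.

(** * Common left multiples in the trace monoid *)

Section TraceLcm.
Context (V : finType) (e : rel V).
Hypotheses (e_sym : symmetric e) (e_irr : irreflexive e).

Lemma trace_perm s t : trace_cong e s t -> perm_eq s t.
Proof.
elim=> {s t} [//|s t _|s t r _ st _ tr|s t u v _]; first by rewrite perm_sym.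
  exact: perm_trans st tr.
by rewrite perm_cat2l (perm_catCA [:: u] [:: v] t).
Qed.

(** A swap exchanges two adjacent vertices, and these cannot both lie in [{a, b}]; irreflexivity
    covers equal letters. The order in which two noncommuting letters alternate is therefore an
    invariant of the trace. *)
Lemma trace_filter2 a b s t : ~~ e a b -> trace_cong e s t ->
  seq.filter (pred2 a b) s = seq.filter (pred2 a b) t.
Proof.
move=> ab; elim=> {s t} [//|//|s t r _ -> _ -> //|s t u v uv].
rewrite !filter_cat /=; congr (_ ++ _).
have : ~~ (((u == a) || (u == b)) && ((v == a) || (v == b))).
  apply/negP => /andP[/orP[]/eqP ua /orP[]/eqP va]; move: uv ab; subst.
  - by rewrite e_irr.
  - by move=> ->.
  - by rewrite e_sym => ->.
  - by rewrite e_irr.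
by case: (_ || _) => //=; case: (_ || _).
Qed.

(** By hypothesis no letter that fails to commute with [v] precedes the first [v], which can thus be
    swapped past its whole prefix. *)
Lemma trace_front v s : v \in s ->
  (forall c, c != v -> ~~ e c v -> ohead (seq.filter (pred2 c v) s) = Some v) ->
  trace_cong e s (v :: rem v s).
Proof.
elim: s => [//|c s IH] /=.
have [-> _ _|cv] := eqVneq c v; first exact: trace_refl.
rewrite inE eq_sym (negbTE cv) /= => vs front.
have ecv : e c v.
  apply/negPn/negP => ecv; have := front c cv ecv.
  by rewrite /= eqxx => -[]; apply/eqP.
apply: (@trace_trans _ _ ([:: c] ++ (v :: rem v s))).
  apply: (@trace_cat _ e [:: c] [:: c]); first exact: trace_refl.
  apply: IH => // d dv edv; have := front d dv edv; rewrite orbF.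
  by have [cd|//] := eqVneq c d; move: edv; rewrite -cd ecv.
exact: (@trace_swap _ e [::] (rem v s) c v).
Qed.

(** Since [v :: t] starts with [v], so does each projection of [u :: s] to [v] and a letter not
    commuting with it. For the letter [u] this is absurd, so [u] and [v] commute; the other letters
    allow [trace_front] on [s]. *)
Lemma trace_cons_lcm u v s t : u != v -> trace_cong e (u :: s) (v :: t) ->
  e u v /\ exists r, trace_cong e s (v :: r) /\ trace_cong e t (u :: r).
Proof.
move=> uv st.
have head c : c != v -> ~~ e c v ->
    ohead (seq.filter (pred2 c v) (u :: s)) = Some v.
  by move=> cv ecv; rewrite (trace_filter2 ecv st) /= eqxx orbT.
split.
  apply/negPn/negP => euv; have := head u uv euv; rewrite /= eqxx /= => -[/eqP].
  by rewrite (negbTE uv).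
(* Deleting the first [v] on both sides leaves [u :: rem v s] congruent to [t], so this is the
   common cofactor. *)
exists (rem v s); split.
  apply: trace_front => [|c cv ecv].
    have := perm_mem (trace_perm st) v.
    by rewrite !inE eqxx eq_sym (negbTE uv).
  have := head c cv ecv; rewrite /= (negbTE uv) orbF.
  by have [<-|//] := eqVneq u c => /= -[/eqP]; rewrite (negbTE uv).
have := trace_rem v st; rewrite /= eqxx (negbTE uv).
exact: trace_sym.
Qed.

Lemma raam_lcm u v (w w' : raam e) : u != v ->
  (raam_gen e u * w = raam_gen e v * w')%g ->
  e u v /\ exists x, (w = raam_gen e v * x)%g /\ (w' = raam_gen e u * x)%g.
Proof.
move=> uv; have [s ->] := raam_repr w; have [t ->] := raam_repr w'.
rewrite !raam_gen_mul => /raam_piP /(trace_cons_lcm uv)[euv [r [sr tr]]].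
split=> //; exists (\pi_(raam e)%qT r).
by rewrite !raam_gen_mul; split; apply/raam_piP.
Qed.

End TraceLcm.

(** * Finitely supported vectors *)

Section FiniteSupport.
Local Open Scope classical_set_scope.
Context (R : realType) (I : choiceType).
Implicit Types (f h : I -> R) (A : set I).

Definition finsupp f := finite_set [set i | f i != 0].

(** The real inner product, meaningful once one argument is finitely supported: a sum with infinite
    support defaults to 0. *)
Definition fdot f h : R := \sum_(i \in [set: I]) f i * h i.

Lemma fdotC f h : fdot f h = fdot h f.
Proof. by apply: eq_fsbigr => i _; rewrite mulrC. Qed.

Lemma fdot_widen A f h : finite_set A -> (forall i, ~ A i -> f i = 0) ->
  fdot f h = \sum_(i <- fset_set A) f i * h i.
Proof.
move=> Afin f0; rewrite -fsbig_finite // /fdot; symmetry; apply: fsbig_widen => //.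
by move=> i [_ /= /f0 ->]; rewrite mul0r.
Qed.

Lemma finsuppP A f : finite_set A -> (forall i, ~ A i -> f i = 0) -> finsupp f.
Proof.
move=> Afin f0; apply: sub_finite_set Afin => i /= fi.
by apply: contrapT => /f0 fi0; rewrite fi0 eqxx in fi.
Qed.

Lemma finsupp_out f i : ~ [set i | f i != 0] i -> f i = 0.
Proof. by move=> /= /negP; rewrite negbK => /eqP. Qed.

Lemma finsuppD c f h : finsupp f -> finsupp h -> finsupp (fun i => f i + c * h i).
Proof.
move=> ff fh; apply: (@finsuppP ([set i | f i != 0] `|` [set i | h i != 0])).
  by rewrite finite_setU.
by move=> i /not_orP[/finsupp_out -> /finsupp_out ->]; rewrite mulr0 addr0.
Qed.

Lemma finsuppZ c f : finsupp f -> finsupp (fun i => c * f i).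
Proof. by move=> ff; apply: finsuppP ff _ => i /finsupp_out ->; rewrite mulr0. Qed.

Lemma finite_support_cover (V : finType) (F : V -> I -> R) :
  (forall v, finsupp (F v)) ->
  exists2 A, finite_set A & forall v i, ~ A i -> F v i = 0.
Proof.
move=> Ffin; exists (\bigcup_v [set i | F v i != 0]).
  by apply: bigcup_finite => // v _; exact: Ffin.
by move=> v i Ai; apply: finsupp_out => Fi; apply: Ai; exists v.
Qed.

Lemma finsupp_sum (V : finType) (F : V -> I -> R) : (forall v, finsupp (F v)) ->
  finsupp (fun i => \sum_v F v i).
Proof.
move=> /finite_support_cover[A Afin F0]; apply: (@finsuppP A) => // i Ai.
by rewrite big1 // => v _; exact: F0.
Qed.

Lemma fdotDl c f1 f2 h : finsupp f1 -> finsupp f2 ->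
  fdot (fun i => f1 i + c * f2 i) h = fdot f1 h + c * fdot f2 h.
Proof.
move=> ff1 ff2; set A := [set i | f1 i != 0] `|` [set i | f2 i != 0].
have Afin : finite_set A by rewrite finite_setU.
have A1 i : ~ A i -> f1 i = 0 by move=> /not_orP[/finsupp_out ->].
have A2 i : ~ A i -> f2 i = 0 by move=> /not_orP[_ /finsupp_out ->].
rewrite !(@fdot_widen A) //; last by move=> i Ai; rewrite A1 // A2 // mulr0 addr0.
rewrite mulr_sumr -big_split; apply: eq_bigr => i _ /=; ring.
Qed.

Lemma fdotDr c f h1 h2 : finsupp h1 -> finsupp h2 ->
  fdot f (fun i => h1 i + c * h2 i) = fdot f h1 + c * fdot f h2.
Proof. by move=> fh1 fh2; rewrite fdotC fdotDl // !(fdotC f). Qed.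

Lemma fdotZl c f h : finsupp f -> fdot (fun i => c * f i) h = c * fdot f h.
Proof.
move=> ff; rewrite !(fdot_widen _ ff) ?mulr_sumr.
- by apply: eq_bigr => i _; rewrite mulrA.
- by move=> i /finsupp_out.
- by move=> i /finsupp_out ->; rewrite mulr0.
Qed.

Lemma fdot_suml (V : finType) (F : V -> I -> R) h : (forall v, finsupp (F v)) ->
  fdot (fun i => \sum_v F v i) h = \sum_v fdot (F v) h.
Proof.
move=> /finite_support_cover[A Afin F0].
rewrite (@fdot_widen A) //; last first.
  by move=> i Ai; rewrite big1 // => v _; exact: F0.
under [RHS]eq_bigr => v _ do rewrite (fdot_widen h Afin (F0 v)).
by rewrite exchange_big; apply: eq_bigr => i _; rewrite mulr_suml.
Qed.

Lemma fdot_ge0 f : 0 <= fdot f f.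
Proof. by apply: fsumr_ge0 => i _; rewrite -expr2 sqr_ge0. Qed.

Lemma fdot_sqrD c f h : finsupp f -> finsupp h ->
  fdot (fun i => f i + c * h i) (fun i => f i + c * h i) =
  fdot f f + 2 * c * fdot f h + c ^+ 2 * fdot h h.
Proof.
move=> ff fh; rewrite fdotDl // !fdotDr // (fdotC h f); ring.
Qed.

(** This is the squared norm of [f + c h]; suitable values of [c] replace the Cauchy-Schwarz
    inequality below. *)
Lemma fdot_quad_ge0 c f h : finsupp f -> finsupp h ->
  0 <= fdot f f + 2 * c * fdot f h + c ^+ 2 * fdot h h.
Proof. by move=> ff fh; rewrite -fdot_sqrD //; exact: fdot_ge0. Qed.

Lemma sum_sqr_le_fdot A f : finite_set A -> finsupp f ->
  \sum_(i <- fset_set A) f i ^+ 2 <= fdot f f.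
Proof.
move=> Afin ff; have Bfin : finite_set (A `|` [set i | f i != 0]).
  by rewrite finite_setU.
have BA : (A `|` [set i | f i != 0]) `&` A = A by apply/setIidPr; left.
rewrite (fdot_widen f Bfin); last by move=> i /not_orP[_ /finsupp_out].
rewrite -!fsbig_finite //= -[X in \sum_(_ \in X) _ ^+ 2 <= _]BA.
rewrite fsbig_mkcondr !fsbig_finite //=; apply: ler_sum => i _.
by rewrite -expr2; case: ifP => // _; exact: sqr_ge0.
Qed.

End FiniteSupport.

(** * Self-improving bounds *)

Section Contraction.
Import numFieldNormedType.Exports.
Local Open Scope classical_set_scope.

(* Every bound K_0 improves to K_(n+1) = a + b K_n, and K_n tends to a / (1 - b). *)
Lemma bound_contraction (R : realType) (T : Type) (D : T -> Prop) (F H : T -> R)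
    (a b K0 : R) : 0 < a -> 0 <= b < 1 -> 0 < K0 ->
  (forall x, D x -> F x <= K0 * H x) ->
  (forall K, 0 < K -> (forall x, D x -> F x <= K * H x) ->
    forall x, D x -> F x <= (a + b * K) * H x) ->
  forall x, D x -> F x <= a / (1 - b) * H x.
Proof.
move=> a0 /andP[b0 b1] K00 FK0 step x Dx; set c := a / (1 - b).
have b1' : 1 - b != 0 by rewrite subr_eq0 eq_sym lt_eqF.
have bound n : 0 < c + b ^+ n * (K0 - c) /\
    forall x, D x -> F x <= (c + b ^+ n * (K0 - c)) * H x.
  elim: n => [|n [Kn0 FKn]]; first by rewrite expr0 mul1r addrC subrK.
  have -> : c + b ^+ n.+1 * (K0 - c) = a + b * (c + b ^+ n * (K0 - c)).
    by rewrite exprS /c; field.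
  by split; [rewrite ltr_pwDl // mulr_ge0 // ltW | exact: step].
have cvgb : (fun n => (c + b ^+ n * (K0 - c)) * H x : R) @ \oo -->
    (c + 0 * (K0 - c)) * H x.
  apply: cvgM; last exact: cvg_cst.
  apply: cvgD; first exact: cvg_cst.
  apply: cvgM; last exact: cvg_cst.
  by apply: cvg_expr; rewrite ger0_norm.
rewrite mul0r addr0 in cvgb.
rewrite -(cvg_lim _ cvgb) //; apply: limr_ge; first by apply/cvg_ex; eexists; exact: cvgb.
by near=> n; have [_] := bound n; exact.
Unshelve. all: by end_near.
Qed.

End Contraction.

(** * Signed shifts satisfying an approximate q-commutation relation *)

(* Common model of the creation operators and of their Clifford twists: [g v]
   acts on the index set of the basis, [sg v] is the accompanying sign, and [s]
   is the sign in the commutation relation of adjacent generators. *)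
Section SignedShifts.
Local Open Scope classical_set_scope.
Context (R : realType) (I : choiceType) (k : nat) (adjacent : rel 'I_k).
Context (g : 'I_k -> I -> I) (sg : 'I_k -> I -> R) (s : R).
Hypothesis adjacent_irr : irreflexive adjacent.
Hypothesis g_inj : forall v, injective (g v).
Hypothesis sg2 : forall v i, sg v i * sg v i = 1.
Hypothesis g_lcm : forall u v i j, u != v -> g u i = g v j ->
  adjacent u v /\ exists w, i = g v w /\ j = g u w.
Hypothesis g_comm : forall u v w, adjacent u v -> g u (g v w) = g v (g u w).
Hypothesis sg_comm : forall u v w, adjacent u v ->
  sg u (g v w) * sg v w = s * (sg v (g u w) * sg u w).
Implicit Types (f h : I -> R) (u v : 'I_k) (c : R).

(** The linear extension of [delta_j |-> sg v j delta_(g v j)], with at most one term as [g v] is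
    injective; [unshift] is its adjoint. *)
Definition shift v f : I -> R := fun i => \sum_(j \in [set j | g v j = i]) sg v j * f j.
Definition unshift v f : I -> R := fun i => sg v i * f (g v i).

Lemma shift_gen v f i : shift v f (g v i) = sg v i * f i.
Proof.
rewrite /shift (_ : [set j | _] = [set i]) ?fsbig_set1 //.
by apply/seteqP; split=> [j /= /g_inj //|j /= ->].
Qed.

Lemma shift_out v f i : ~ range (g v) i -> shift v f i = 0.
Proof.
move=> ni; rewrite /shift (_ : [set j | _] = set0) ?fsbig_set0 //.
by apply/seteqP; split=> // j /= ji; apply: ni; exists j.
Qed.

Lemma shiftD c v f h i :
  shift v (fun j => f j + c * h j) i = shift v f i + c * shift v h i.
Proof.
have [[j _ <-]|ni] := pselect (range (g v) i); first by rewrite !shift_gen; ring.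
by rewrite !shift_out // mulr0 addr0.
Qed.

Lemma finsupp_shift v f : finsupp f -> finsupp (shift v f).
Proof.
move=> ff; apply: (@finsuppP _ _ (g v @` [set i | f i != 0])).
  by apply: finite_image; exact: ff.
move=> i ni; have [[j _ ji]|] := pselect (range (g v) i); last exact: shift_out.
rewrite -ji shift_gen (@finsupp_out _ _ f) ?mulr0 // => fj.
by apply: ni; exists j.
Qed.

Lemma finsupp_unshift v f : finsupp f -> finsupp (unshift v f).
Proof.
move=> ff; apply: (@finsuppP _ _ (g v @^-1` [set i | f i != 0])).
  by apply: finite_preimage => // i j _ _; exact: g_inj.
by move=> i ni; rewrite /unshift (@finsupp_out _ _ f) ?mulr0.
Qed.

Lemma fdot_shift v f h : finsupp f -> fdot (shift v f) h = fdot f (unshift v h).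
Proof.
move=> ff; have gfin := @finite_image _ _ _ (g v) ff.
rewrite (@fdot_widen _ _ (g v @` [set i | f i != 0])) //; last first.
  move=> i ni; have [[j _ ji]|] := pselect (range (g v) i); last exact: shift_out.
  rewrite -ji shift_gen (@finsupp_out _ _ f) ?mulr0 // => fj.
  by apply: ni; exists j.
rewrite -fsbig_finite //= fsbig_image; last by move=> i j _ _; exact: g_inj.
rewrite (fdot_widen _ ff) ?fsbig_finite //=; last exact: (@finsupp_out _ _ f).
by apply: eq_bigr => i _; rewrite shift_gen /unshift; ring.
Qed.

Lemma unshift_shift v f : unshift v (shift v f) = f.
Proof. by apply/funext => i; rewrite /unshift shift_gen mulrA sg2 mul1r. Qed.

(** If [g u i] lies in the range of [g v], then [g_lcm] makes [u] and [v] adjacent and puts [i] in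
    the range of [g v]. Both sides thus vanish off that range, and also when [u] and [v] are not
    adjacent. Otherwise only the signs remain to be compared. *)
Lemma unshift_shift_neq u v f : u != v ->
  unshift u (shift v f) = fun i => s * (adjacent u v)%:R * shift v (unshift u f) i.
Proof.
move=> uv; apply/funext => i; rewrite /unshift.
have [[w _ <-]|ni] := pselect (range (g v) i); last first.
  rewrite !shift_out ?mulr0 // => -[j _ /esym/(g_lcm uv)[_ [w [iw _]]]].
  by apply: ni; exists w.
case: (boolP (adjacent u v)) => auv; last first.
  rewrite shift_out ?mulr0 ?mul0r // => -[j _ /esym/(g_lcm uv)[]].
  by rewrite (negbTE auv).
rewrite g_comm // !shift_gen mulr1.
(* [sg_comm] multiplied by [sg v w * sg v (g u w)], arranged so that squares of signs drop out. *)
have : sg u (g v w) * sg v (g u w) * (sg v w * sg v w) =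
       s * (sg v w * sg u w) * (sg v (g u w) * sg v (g u w)).
  by transitivity (sg u (g v w) * sg v w * (sg v w * sg v (g u w)));
    [ring | rewrite sg_comm //; ring].
rewrite !sg2 !mulr1 => ss; rewrite mulrA ss; ring.
Qed.

Lemma fdot_shift_shift u v f : finsupp f ->
  fdot (shift u f) (shift v f) =
  (u == v)%:R * fdot f f + s * (adjacent u v)%:R * fdot (unshift u f) (unshift v f).
Proof.
move=> ff; rewrite fdot_shift //; have [->|uv] := eqVneq u v.
  by rewrite unshift_shift adjacent_irr mul1r mulr0 mul0r addr0.
rewrite unshift_shift_neq // fdotC fdotZl; last exact/finsupp_shift/finsupp_unshift.
by rewrite fdot_shift ?mul0r ?add0r //; exact: finsupp_unshift.
Qed.

(* For words: the letters with which the word [i] can start. *)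
Definition starting (i : I) := [set v : 'I_k | `[< range (g v) i >]]%SET.

(** Two first letters of one element have a common left multiple. Hence [starting i] is a clique,
    which is how the clique number enters. *)
Lemma starting_adjacent i u v :
  u \in starting i -> v \in starting i -> u != v -> adjacent u v.
Proof.
rewrite !inE => /asboolP[j _ ji] /asboolP[j' _ j'i] uv.
by have [] := g_lcm uv (etrans ji (esym j'i)).
Qed.

Lemma shift_unshift v f i : shift v (unshift v f) i = (v \in starting i)%:R * f i.
Proof.
rewrite inE; case: asboolP => [[j _ <-]|ni]; last by rewrite shift_out ?mul0r.
by rewrite shift_gen /unshift mulrA sg2.
Qed.

(** Each [l_v l_v'] is the projection onto the range of [g v], so their sum is diagonal with entry
    [#|starting i|] at [i]. *)
Lemma sum_unshift_le (omega : nat) f : (forall i, #|starting i| <= omega)%N ->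
  finsupp f -> \sum_v fdot (unshift v f) (unshift v f) <= omega%:R * fdot f f.
Proof.
move=> clq ff; rewrite (eq_bigr (fun v => fdot (shift v (unshift v f)) f)); last first.
  by move=> v _; rewrite fdot_shift //; exact: finsupp_unshift.
rewrite -fdot_suml; last by move=> v; exact/finsupp_shift/finsupp_unshift.
rewrite !(fdot_widen _ ff); [|exact: (@finsupp_out _ _ f)|]; last first.
  move=> i /(@finsupp_out _ _ f) fi; rewrite big1 // => v _.
  by rewrite shift_unshift fi mulr0.
rewrite mulr_sumr; apply: ler_sum => i _.
under eq_bigr => v _ do rewrite shift_unshift.
rewrite -mulr_suml -mulrA -natr_sum; apply: ler_wpM2r.
  by rewrite -expr2 sqr_ge0.
rewrite ler_nat; apply: leq_trans (clq i).
by rewrite -sum1_card [leqRHS]big_mkcond; apply: leq_sum => v _; case: (v \in _).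
Qed.

(** * Norm of the normalized sum of signed shifts *)

Section NormalizedSum.
Context (p mu : R) (omega : nat).
Hypothesis k_gt0 : (0 < k)%N.
Hypothesis p_ge0 : 0 <= p.
Hypothesis p_lt1 : p < 1.
Hypothesis s_sign : s = 1 \/ s = -1.
Hypothesis mu_ge0 : 0 <= mu.
Hypothesis centred_le : forall x : 'I_k -> R,
  `|\sum_u \sum_(v | v != u) ((adjacent u v)%:R - p) * x u * x v| <=
  mu * \sum_u x u ^+ 2.
Hypothesis starting_le : forall i, (#|starting i| <= omega)%N.

Let q := s * p.
Let delta := (p + mu) * omega%:R / k%:R.
Let nk : R := (Num.sqrt k%:R)^-1.

Let nk2 : nk ^+ 2 = k%:R^-1.
Proof. by rewrite /nk exprVn sqr_sqrtr. Qed.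

Let k0 : (k%:R : R) != 0. Proof. by rewrite pnatr_eq0 -lt0n. Qed.

Let kp : 0 < (k%:R : R). Proof. by rewrite ltr0n. Qed.

Let delta_ge0 : 0 <= delta.
Proof. by rewrite /delta !mulr_ge0 ?addr_ge0 ?invr_ge0. Qed.

Definition mean_shift f : I -> R := fun i => nk * \sum_v shift v f i.
Definition mean_unshift f : I -> R := fun i => nk * \sum_v unshift v f i.
Local Notation L := mean_shift.
Local Notation Ls := mean_unshift.

Lemma finsupp_mean_shift f : finsupp f -> finsupp (L f).
Proof. by move=> ff; apply/finsuppZ/finsupp_sum => v; exact: finsupp_shift. Qed.

Lemma finsupp_mean_unshift f : finsupp f -> finsupp (Ls f).
Proof. by move=> ff; apply/finsuppZ/finsupp_sum => v; exact: finsupp_unshift. Qed.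

Lemma fdot_mean_shift f h : finsupp f -> finsupp h -> fdot (L f) h = fdot f (Ls h).
Proof.
move=> ff fh; have sf v := finsupp_shift v ff; have sh v := finsupp_unshift v fh.
rewrite fdotZl ?fdot_suml //; last exact: finsupp_sum.
rewrite fdotC fdotZl ?fdot_suml //; last exact: finsupp_sum.
by congr (_ * _); apply: eq_bigr => v _; rewrite fdot_shift // fdotC.
Qed.

Lemma fdot_sum2 (F : 'I_k -> I -> R) : (forall v, finsupp (F v)) ->
  fdot (fun i => nk * \sum_v F v i) (fun i => nk * \sum_v F v i) =
  k%:R^-1 * \sum_u \sum_v fdot (F u) (F v).
Proof.
move=> Ff; rewrite fdotZl; last exact: finsupp_sum.
rewrite fdotC fdotZl; last exact: finsupp_sum.
rewrite mulrA -expr2 nk2 fdot_suml //; congr (_ * _).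
apply: eq_bigr => u _; rewrite fdotC fdot_suml //.
by apply: eq_bigr => v _; rewrite fdotC.
Qed.

(** At each index [i] of a common finite support, [centred_le] applies to the vector
    [u |-> unshift u f i]; these inequalities are summed over [i]. *)
Lemma centred_fdot_le f : finsupp f ->
  `|\sum_u \sum_(v | v != u) ((adjacent u v)%:R - p) *
     fdot (unshift u f) (unshift v f)| <=
  mu * \sum_u fdot (unshift u f) (unshift u f).
Proof.
move=> ff; have sf v := finsupp_unshift v ff.
have [A Afin A0] := finite_support_cover sf.
have dotE u v : fdot (unshift u f) (unshift v f) =
    \sum_(i <- fset_set A) unshift u f i * unshift v f i.
  by rewrite (fdot_widen _ Afin) //; exact: A0.
under eq_bigr => u _ do under eq_bigr => v _ do rewrite dotE mulr_sumr.
under eq_bigr => u _ do rewrite exchange_big.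
rewrite exchange_big /=; apply: le_trans (ler_norm_sum _ _ _) _.
under [X in _ <= _ * X]eq_bigr => u _ do rewrite dotE.
rewrite exchange_big /= mulr_sumr; apply: ler_sum => i _.
under eq_bigr => u _ do under eq_bigr => v _ do rewrite mulrA.
exact: centred_le.
Qed.

(* The relation [a' a = 1 + q a a'] between [a] and its adjoint [a'], up to an
   error [delta]. *)
Lemma approx_q_relation f : finsupp f ->
  `|fdot (L f) (L f) - fdot f f - q * fdot (Ls f) (Ls f)| <= delta * fdot f f.
Proof.
move=> ff; have sf v := finsupp_shift v ff; have uf v := finsupp_unshift v ff.
rewrite !fdot_sum2 //.
set a := fun u v => fdot (unshift u f) (unshift v f).
set Z := \sum_u \sum_(v | v != u) ((adjacent u v)%:R - p) * a u v.
have -> : \sum_u \sum_v fdot (shift u f) (shift v f) =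
    k%:R * fdot f f + s * \sum_u \sum_v (adjacent u v)%:R * a u v.
  under eq_bigr => u _ do under eq_bigr => v _ do rewrite fdot_shift_shift //.
  under eq_bigr => u _ do rewrite big_split.
  rewrite big_split; congr (_ + _).
    under eq_bigr => u _.
      rewrite (bigD1 u) //= eqxx mul1r big1 ?addr0; last first.
        by move=> v; rewrite eq_sym => /negbTE ->; rewrite mul0r.
      over.
    by rewrite sumr_const card_ord mulr_natl.
  rewrite mulr_sumr; apply: eq_bigr => u _; rewrite mulr_sumr.
  by apply: eq_bigr => v _; rewrite mulrA.
(* Adjacency is [p] plus its centred part off the diagonal and 0 on it; completing to all pairs
   costs [p] times the diagonal. *)
have -> : \sum_u \sum_v (adjacent u v)%:R * a u v =
    p * (\sum_u \sum_v a u v) - p * (\sum_u a u u) + Z.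
  rewrite !mulr_sumr -sumrB -big_split; apply: eq_bigr => u _ /=.
  rewrite mulr_sumr (bigD1 u) //= adjacent_irr mul0r add0r.
  rewrite [in RHS](bigD1 u) //= [_ + _ - _]addrAC subrr add0r -big_split.
  by apply: eq_bigr => v _ /=; ring.
set Y := \sum_u a u u; set T := \sum_u \sum_v a u v.
have -> : k%:R^-1 * (k%:R * fdot f f + s * (p * T - p * Y + Z)) - fdot f f -
    q * (k%:R^-1 * T) = s * (k%:R^-1 * (Z - p * Y)).
  by rewrite /q; field.
have -> : `|s * (k%:R^-1 * (Z - p * Y))| = k%:R^-1 * `|Z - p * Y|.
  rewrite !normrM; have -> : `|s| = 1.
    by case: s_sign => ->; rewrite ?normrN normr1.
  by rewrite mul1r ger0_norm ?invr_ge0.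
have Y0 : 0 <= Y by apply: sumr_ge0 => u _; exact: fdot_ge0.
have hZ : `|Z| <= mu * Y := centred_fdot_le ff.
have hY : Y <= omega%:R * fdot f f := sum_unshift_le starting_le ff.
rewrite /delta [leRHS]mulrAC [leRHS]mulrC; apply: ler_wpM2l.
  by rewrite invr_ge0.
apply: le_trans (ler_normB _ _) _; rewrite (ger0_norm (mulr_ge0 p_ge0 Y0)).
rewrite -mulrA; apply: le_trans (_ : (p + mu) * Y <= _).
  by rewrite mulrDl; lra.
by apply: ler_wpM2l => //; rewrite addr_ge0.
Qed.

(** By [2 a u v <= a u u + a v v] the double sum is at most [k] times its diagonal. The bound
    depends on [omega] and serves to start the contraction in [mean_shift_le]. *)
Let mean_unshift_crude f : finsupp f -> fdot (Ls f) (Ls f) <= omega%:R * fdot f f.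
Proof.
move=> ff; have uf v := finsupp_unshift v ff.
apply: le_trans (sum_unshift_le starting_le ff); rewrite fdot_sum2 //.
set a := fun u v => fdot (unshift u f) (unshift v f).
rewrite ler_pdivrMl // mulr_natl.
apply: le_trans (_ : \sum_u \sum_v (a u u + a v v) / 2 <= _).
  apply: ler_sum => u _; apply: ler_sum => v _.
  by have := fdot_quad_ge0 (-1) (uf u) (uf v); rewrite /a; lra.
under eq_bigr => u _ do rewrite -mulr_suml big_split sumr_const card_ord.
rewrite -mulr_suml big_split sumr_const card_ord /= -sumrMnl.
by rewrite le_eqVlt -mulr2n -[X in X / 2]mulr_natr mulfK ?eqxx.
Qed.

(** An operator and its adjoint share their bounds: expanding the square of [L (Ls f) - K f] and
    using the bound at [Ls f] leaves [0 <= K (K F - N)]. *)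
Let mean_unshift_le K f : 0 < K ->
  (forall h, finsupp h -> fdot (L h) (L h) <= K * fdot h h) ->
  finsupp f -> fdot (Ls f) (Ls f) <= K * fdot f f.
Proof.
move=> K0 hK ff; have fLs := finsupp_mean_unshift ff.
have := fdot_quad_ge0 (- K) (finsupp_mean_shift fLs) ff.
rewrite (fdot_mean_shift fLs ff); have := hK _ fLs.
set N := fdot (Ls f) (Ls f); set M := fdot (L _) _; set F := fdot f f => h1 h2.
have : 0 <= K * (K * F - N) by lra.
by rewrite pmulr_rge0 // subr_ge0.
Qed.

Let q_lt1 : q < 1.
Proof.
rewrite /q; case: s_sign => ->; first by rewrite mul1r.
by rewrite mulN1r (le_lt_trans _ ltr01) // oppr_le0.
Qed.

(** A bound [K] on [L] passes to [Ls], and the approximate relation improves it to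
    [1 + delta + q K]; the limit of the iteration is the fixed point of this map. The crude bound
    inserted once gives the initial constant. *)
Lemma mean_shift_le f : 0 <= q -> finsupp f ->
  fdot (L f) (L f) <= (1 + delta) / (1 - q) * fdot f f.
Proof.
move=> q0.
apply: (@bound_contraction _ _ (@finsupp R I) (fun f => fdot (L f) (L f))
  (fun f => fdot f f) _ _ (1 + delta + q * omega%:R)).
- by rewrite ltr_pwDl.
- by rewrite q0 q_lt1.
- by rewrite -addrA ltr_pwDl // addr_ge0 // mulr_ge0.
- move=> h fh; have := approx_q_relation fh; rewrite ler_norml => /andP[_].
  have := ler_wpM2l q0 (mean_unshift_crude fh); lra.
- move=> K K0 hK h fh; have := approx_q_relation fh; rewrite ler_norml => /andP[_].
  have := ler_wpM2l q0 (mean_unshift_le K0 hK fh); lra.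
Qed.

(* For [q < 0] the bound on the numerical range is the sum of squares
   [(1 - q)(2 - b - b') = (1 - b') (1 - b) + |q| (1 - b) (1 - b')]
   with [b = sqrt (1 - q) a] and [b'] its adjoint; for [0 <= q] the first square
   suffices, by the norm bound on [a]. *)
Lemma mean_shift_range c f : c ^+ 2 = 1 - q -> finsupp f ->
  2 * c * fdot (L f) f <= (2 + delta) * fdot f f.
Proof.
move=> c2 ff; have fL := finsupp_mean_shift ff; have fLs := finsupp_mean_unshift ff.
have := fdot_quad_ge0 (- c) ff fL; have := fdot_quad_ge0 (- c) ff fLs.
rewrite -fdot_mean_shift // (fdotC f (L f)) sqrrN c2.
set P := fdot (L f) f; set F := fdot f f; set N := fdot (L f) (L f).
set Ns := fdot (Ls f) (Ls f) => h2 h1.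
have q1 : 0 < 1 - q by rewrite subr_gt0.
have [q0|q0] := leP 0 q.
  have := mean_shift_le q0 ff; rewrite mulrAC ler_pdivlMr // -/N -/F; lra.
have := approx_q_relation ff; rewrite ler_norml => /andP[_]; rewrite -/N -/F -/Ns => h3.
(* With weight [- q] on the square involving [Ls], the terms in [Ns] cancel against those of the
   relation multiplied by [1 - q]. *)
have h4 := mulr_ge0 (ltW (_ : 0 < - q)) h2.
have {}h4 := h4 ltac:(lra).
have h5 := ler_wpM2l (ltW q1) h3.
suff : (1 - q) * (2 * c * P) <= (1 - q) * ((2 + delta) * F) by rewrite ler_pM2l.
nra.
Qed.

Let lam := (2 + delta) / Num.sqrt (1 - q).

Definition mean_self f : I -> R := fun i => L f i + Ls f i.
Local Notation X := mean_self.

Let XE f : X f = fun i => L f i + 1 * Ls f i.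
Proof. by apply/funext => i; rewrite mul1r. Qed.

Lemma finsupp_mean_self f : finsupp f -> finsupp (X f).
Proof.
move=> ff; rewrite XE.
by apply: finsuppD; [exact: finsupp_mean_shift | exact: finsupp_mean_unshift].
Qed.

Lemma fdot_mean_self f h : finsupp f -> finsupp h ->
  fdot (X f) h = fdot (L f) h + fdot (L h) f.
Proof.
move=> ff fh; rewrite XE fdotDl ?mul1r; [|exact: finsupp_mean_shift|exact: finsupp_mean_unshift].
by rewrite (fdotC (Ls f)) -fdot_mean_shift.
Qed.

Lemma mean_selfD c f h : X (fun i => f i + c * h i) = fun i => X f i + c * X h i.
Proof.
apply/funext => i; rewrite /mean_self /mean_shift /mean_unshift.
under eq_bigr => v _ do rewrite shiftD.
rewrite !big_split -mulr_sumr /unshift.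
under [X in _ + nk * X = _]eq_bigr => v _ do rewrite mulrDr mulrCA.
rewrite big_split -mulr_sumr /=; ring.
Qed.

Let lam_gt0 : 0 < lam.
Proof. by rewrite divr_gt0 ?sqrtr_gt0 ?subr_gt0 // ltr_pwDl. Qed.

Lemma mean_self_range f : finsupp f -> `|fdot (X f) f| <= lam * fdot f f.
Proof.
move=> ff; have r0 : 0 < Num.sqrt (1 - q) by rewrite sqrtr_gt0 subr_gt0.
have r2 : Num.sqrt (1 - q) ^+ 2 = 1 - q by rewrite sqr_sqrtr // subr_ge0 ltW.
have h1 := mean_shift_range r2 ff.
have h2 : 2 * (- Num.sqrt (1 - q)) * fdot (L f) f <= (2 + delta) * fdot f f.
  by apply: mean_shift_range => //; rewrite sqrrN.
rewrite fdot_mean_self // /lam mulrAC ler_pdivlMr // -[X in `|_| * X]gtr0_norm //.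
rewrite -normrM ler_norml; apply/andP; split; lra.
Qed.

(** For a symmetric operator the numerical range controls the norm. In the difference of the forms
    at [f + c X f] and [f - c X f] only [4 c |X f|^2] survives, and [c = lam^-1] balances the
    right-hand side. *)
Lemma mean_self_le f : finsupp f ->
  fdot (X f) (X f) <= lam ^+ 2 * fdot f f.
Proof.
move=> ff; have fX := finsupp_mean_self ff.
have range c : `|fdot (X f) f + c * (2 * fdot (X f) (X f)) +
                  c ^+ 2 * fdot (X (X f)) (X f)|
    <= lam * (fdot f f + 2 * c * fdot (X f) f + c ^+ 2 * fdot (X f) (X f)).
  have := mean_self_range (finsuppD c ff fX).
  rewrite fdot_sqrD // (fdotC f (X f)) mean_selfD.
  rewrite (fdotDl c _ fX (finsupp_mean_self fX)) !(fdotDr c _ ff fX).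
  have <- : fdot (X f) (X f) = fdot (X (X f)) f.
    by rewrite (fdot_mean_self ff fX) (fdot_mean_self fX ff) addrC.
  set u := (X in `|X|); set v := (X in _ -> `|X| <= _).
  by suff -> : u = v; rewrite // /u /v; ring.
have := range lam^-1; have := range (- lam^-1).
rewrite !ler_norml => /andP[h1 _] /andP[_ h2].
have l0 : lam != 0 by rewrite gt_eqF.
set G := fdot (X f) (X f) in h1 h2 *; set F := fdot f f in h1 h2 *.
set P := fdot (X f) f in h1 h2; set Q := fdot (X (X f)) (X f) in h1 h2.
have e1 : lam * (lam^-1 ^+ 2 * G) = lam^-1 * G by field.
have e2 c : lam * (F + 2 * c * P + c ^+ 2 * G) =
  lam * F + 2 * c * lam * P + lam * (c ^+ 2 * G) by ring.
rewrite !e2 sqrrN e1 in h1 h2.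
have {}h : lam^-1 * G <= lam * F by lra.
by rewrite expr2 -mulrA -ler_pdivrMl // mulrC.
Qed.

(** On [A], [X f] only sees the values of [f] on [A] and on its images and preimages under the
    [g v]. Truncating [f] there extends the norm bound to vectors of arbitrary support. *)
Lemma mean_self_local (A : set I) : finite_set A ->
  exists2 N : set I, finite_set N & forall f,
    \sum_(i <- fset_set A) X f i ^+ 2 <= lam ^+ 2 * \sum_(i <- fset_set N) f i ^+ 2.
Proof.
move=> Afin; pose N := A `|` ((\bigcup_v g v @` A) `|` (\bigcup_v g v @^-1` A)).
have Nfin : finite_set N.
  rewrite !finite_setU; split=> //; split; apply: bigcup_finite => // v _.
    exact: finite_image.
  by apply: finite_preimage => // i j _ _; exact: g_inj.
exists N => // f; pose f' i := if i \in N then f i else 0.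
have f'0 i : ~ N i -> f' i = 0 by move=> Ni; rewrite /f' memNset.
have ff' : finsupp f' by exact: finsuppP Nfin f'0.
have f'N i : N i -> f' i = f i by move=> Ni; rewrite /f' mem_set.
have Xf' i : A i -> X f' i = X f i.
  move=> Ai; rewrite /mean_self /mean_shift /mean_unshift.
  congr (_ * _ + _ * _); apply: eq_bigr => v _.
    apply: eq_fsbigr => j /set_mem /= ji; rewrite f'N //.
    by right; right; exists v => //=; rewrite ji.
  by rewrite /unshift f'N //; right; left; exists v => //; exists i.
have -> : \sum_(i <- fset_set N) f i ^+ 2 = fdot f' f'.
  rewrite (fdot_widen _ Nfin) //; apply: eq_big_seq => i.
  by rewrite in_fset_set // => /set_mem Ni; rewrite f'N.
apply: le_trans (mean_self_le ff').
rewrite (_ : \sum_(i <- _) _ = \sum_(i <- fset_set A) X f' i ^+ 2); last first.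
  by apply: eq_big_seq => i; rewrite in_fset_set // => /set_mem /Xf' ->.
exact: sum_sqr_le_fdot Afin (finsupp_mean_self ff').
Qed.

(** The coefficients are real, so real and imaginary parts evolve separately. The squared norm of
    the image is a supremum over finite sets, each handled by [mean_self_local]. *)
Lemma opnorm_normalized_sum_le (T : 'I_k -> op R I) :
  (forall v xi i, T v xi (g v i) = (sg v i)%:C%C * xi i) ->
  (forall v xi i, ~ range (g v) i -> T v xi i = 0) ->
  (forall v eta i, adj (T v) eta i = (sg v i)%:C%C * eta (g v i)) ->
  (opnorm (normalized_sum (fun v => op_self (T v))) <= lam%:E)%E.
Proof.
move=> Tgen Tout Tadj.
have complexM (a : R) (z : R[i]) : a%:C%C * z = (a * complex.Re z +i* (a * complex.Im z))%C.
  by case: z => x y; rewrite /= /GRing.mul /= !mul0r subr0 addr0.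
have TE v xi i : T v xi i = (shift v (fun j => complex.Re (xi j)) i +i*
                             shift v (fun j => complex.Im (xi j)) i)%C.
  have [[j _ <-]|ni] := pselect (range (g v) i); last by rewrite Tout // !shift_out.
  by rewrite Tgen !shift_gen complexM.
have sumE (F G : 'I_k -> R) :
    \sum_v (F v +i* G v)%C = ((\sum_v F v) +i* (\sum_v G v))%C.
  elim/big_ind3: _ => //= x1 x2 x3 y1 y2 y3 -> ->; exact: erefl.
have normE xi i : normalized_sum (fun v => op_self (T v)) xi i =
    (X (fun j => complex.Re (xi j)) i +i* X (fun j => complex.Im (xi j)) i)%C.
  rewrite /normalized_sum /op_self.
  under eq_bigr => v _ do rewrite TE Tadj complexM.
  rewrite (eq_bigr (fun v =>
    ((shift v (fun j => complex.Re (xi j)) i + unshift v (fun j => complex.Re (xi j)) i) +i*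
     (shift v (fun j => complex.Im (xi j)) i + unshift v (fun j => complex.Im (xi j)) i))%C)) //.
  by rewrite sumE complexM /= !big_split !mulrDr.
apply: ge_ereal_sup => _ [xi /= xi1 <-].
have -> : lam%:E = sqrte (lam ^+ 2)%:E by rewrite /= sqrtr_sqr gtr0_norm.
rewrite /l2norm lee_sqrt ?lee_fin ?sqr_ge0 //.
apply: ge_ereal_sup => _ [A [Afin _] <-].
have [N Nfin leN] := mean_self_local Afin.
rewrite fsbig_finite // sumEFin lee_fin.
under eq_bigr => i _ do rewrite normE /=.
rewrite big_split; apply: le_trans (lerD (leN _) (leN _)) _.
rewrite -mulrDr -big_split -[leRHS]mulr1 ler_wpM2l ?sqr_ge0 //=.
move: xi1; have -> : 1%E = sqrte 1%E :> \bar R by rewrite /= sqrtr1.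
rewrite /l2norm lee_sqrt // => xi1; rewrite -lee_fin; apply: le_trans xi1.
by apply: esum_ge; exists N; rewrite // fsbig_finite // sumEFin.
Qed.

End NormalizedSum.
End SignedShifts.

(** * The norm for a fixed graph *)

Section QNorm.
Context (R : realType) (k : nat) (G : graph k).

Definition clique_le (omega : nat) := forall K : {set 'I_k},
  {in K &, forall u v, u != v -> edge_rel G u v} -> (#|K| <= omega)%N.

Definition centred_form_le (p mu : R) := forall x : 'I_k -> R,
  `|\sum_u \sum_(v | v != u) ((edge_rel G u v)%:R - p) * x u * x v| <=
  mu * \sum_u x u ^+ 2.

Lemma symd_sign_real (S T : {set 'I_k}) :
  (complex.Re (symd_sign R S T))%:C%C = symd_sign R S T.
Proof.
have /eqP := symd_sign2 R S T; rewrite -expr2 sqrf_eq1.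
by case/orP => /eqP ->; rewrite //= /GRing.opp /= oppr0.
Qed.

(** Two instances of the signed shifts, with [q = s |q|]: for [q < 0] the index is a subset paired
    with a trace, the signs are those of the Clifford product and [s = -1]; for [0 <= q] the index
    is a trace, all signs are 1 and [s = 1]. *)
Lemma q_norm_le (q mu : R) (omega : nat) : -1 < q < 1 -> (0 < k)%N -> 0 <= mu ->
  clique_le omega -> centred_form_le `|q| mu ->
  (q_norm q G <=
    ((2 + (`|q| + mu) * omega%:R / k%:R) / Num.sqrt (1 - q))%:E)%E.
Proof.
move=> /andP[q1 q2] k0 mu0 clq cent.
have irr := @edge_rel_irr _ G; have sym := @edge_rel_sym _ G.
have aq1 : `|q| < 1 by rewrite ltr_norml q1.
rewrite /q_norm; case: ifPn => [q0|]; last first.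
  rewrite -ltNge => q0.
  pose g v (p : {set 'I_k} * raam (edge_rel G)) :=
    (symd [set v]%SET p.1, (raam_gen (edge_rel G) v * p.2)%g).
  pose sg v (p : {set 'I_k} * raam (edge_rel G)) := complex.Re (symd_sign R [set v]%SET p.1).
  have ginj v : injective (g v).
    move=> [S w] [S' w'] [/(congr1 (symd [set v]%SET))].
    by rewrite !symdK => -> /raam_gen_inj ->.
  have sg2 v i : sg v i * sg v i = 1.
    by apply: (@complexI R); rewrite rmorphM /= !symd_sign_real symd_sign2.
  have glcm u v i j : u != v -> g u i = g v j ->
      edge_rel G u v /\ exists w, i = g v w /\ j = g u w.
    case: i => S w; case: j => S' w' uv [eS /(raam_lcm sym irr uv)[euv [x [-> ->]]]].
    (* The traces supply the cofactor [x]; the subset is forced, as symmetric difference with a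
       fixed set is an involution. *)
    split=> //; exists (symd [set v]%SET S, x); rewrite /g /=; split; rewrite ?symdK //.
    by rewrite -[in LHS](symdK [set v]%SET S') -eS symdA symdA (symdC [set u]%SET).
  have gcomm u v w : edge_rel G u v -> g u (g v w) = g v (g u w).
    move=> euv; rewrite /g /= !mulgA (raam_genC euv); congr pair.
    by rewrite !symdA (symdC [set u]%SET).
  have sgcomm u v w : edge_rel G u v ->
      sg u (g v w) * sg v w = -1 * (sg v (g u w) * sg u w).
    move=> euv; have uv : u != v by apply: contraTneq euv => ->; rewrite irr.
    apply: (@complexI R); rewrite mulN1r rmorphN !rmorphM /= !symd_sign_real.
    (* Bimultiplicativity leaves the signs of [c_u c_v] and [c_v c_u], exactly one of which is
       -1. *)
    rewrite !symd_sign_symr !symd_sign1.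
    by case: (ltngtP u v) => [_|_|/val_inj /eqP]; rewrite ?(negbTE uv) //; ring.
  have qE : q = -1 * `|q| by rewrite ltr0_norm // mulrNN mul1r.
  rewrite [in X in (_ <= X)%E]qE normrM normrN normr1 mul1r normr_id.
  apply: (opnorm_normalized_sum_le irr ginj sg2 glcm gcomm sgcomm) => //.
  - by right.
  - move=> i; apply: clq => u v; exact: (starting_adjacent glcm).
  - by move=> v xi i; rewrite symd_sign_real; exact: twisted_gen.
  - move=> v xi i; exact: twisted_out.
  - by move=> v xi i; rewrite symd_sign_real; exact: adj_twisted.
pose g v (w : raam (edge_rel G)) := (raam_gen (edge_rel G) v * w)%g.
pose sg (v : 'I_k) (w : raam (edge_rel G)) := 1 : R.
have ginj v : injective (g v) by exact: raam_gen_inj.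
have sg2 v i : sg v i * sg v i = 1 by rewrite mulr1.
have glcm u v i j : u != v -> g u i = g v j ->
    edge_rel G u v /\ exists w, i = g v w /\ j = g u w.
  exact: raam_lcm.
have gcomm u v w : edge_rel G u v -> g u (g v w) = g v (g u w).
  by move=> euv; rewrite /g !mulgA raam_genC.
have sgcomm u v w : edge_rel G u v ->
    sg u (g v w) * sg v w = 1 * (sg v (g u w) * sg u w).
  by rewrite /sg !mulr1.
rewrite ger0_norm // in cent aq1 *; rewrite -[X in 1 - X]mul1r.
apply: (opnorm_normalized_sum_le irr ginj sg2 glcm gcomm sgcomm) => //.
- by left.
- move=> i; apply: clq => u v; exact: (starting_adjacent glcm).
- by move=> v xi i; rewrite mul1r; exact: creation_gen.
- move=> v xi i; exact: creation_out.
- by move=> v xi i; rewrite mul1r; exact: adj_creation.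
Qed.

End QNorm.

(** * Random graphs *)

Section ErdosRenyi.
Context (R : realType) (k : nat) (p : R).
Hypothesis p01 : 0 <= p <= 1.
Implicit Types (A B : pred (graph k)) (G : graph k) (e : edge k).

Lemma er_weight_ge0 G : 0 <= er_weight p G.
Proof.
case/andP: p01 => p0 p1; apply: prodr_ge0 => e _.
by case: ifP => _; rewrite ?subr_ge0.
Qed.

Lemma er_prob_ge0 A : 0 <= er_prob p A.
Proof. by apply: sumr_ge0 => G _; exact: er_weight_ge0. Qed.

Lemma er_prob_mono A B : (forall G, A G -> B G) -> er_prob p A <= er_prob p B.
Proof.
move=> AB; rewrite /er_prob big_mkcond [leRHS]big_mkcond; apply: ler_sum => G _.
case: ifP => [/AB ->//|_]; case: ifP => // _; exact: er_weight_ge0.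
Qed.

Lemma er_probC A : er_prob p A = 1 - er_prob p (fun G => ~~ A G).
Proof. by rewrite -(er_probT k p) /er_prob [X in X - _](bigID A) /= addrK. Qed.

Lemma er_prob_exists (S : finType) (Q : pred S) (A : S -> pred (graph k)) B :
  (forall G, B G -> exists2 x, Q x & A x G) ->
  er_prob p B <= \sum_(x | Q x) er_prob p (A x).
Proof.
move=> BA; rewrite /er_prob; under [leRHS]eq_bigr => x _ do rewrite big_mkcond.
rewrite exchange_big big_mkcond; apply: ler_sum => G _ /=.
have nneg x : 0 <= (if A x G then er_weight p G else 0).
  by case: ifP => _ //; exact: er_weight_ge0.
case: ifP => [/BA[x Qx Ax]|_]; last by apply: sumr_ge0.
by rewrite (bigD1 x) //= Ax lerDl sumr_ge0.
Qed.

Lemma er_prob_or A B :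
  er_prob p (fun G => A G || B G) <= er_prob p A + er_prob p B.
Proof.
rewrite (_ : _ + _ = \sum_(b : bool) er_prob p (if b then A else B)).
  by apply: er_prob_exists => G /orP[]; [exists true|exists false].
by rewrite big_bool.
Qed.

(** Independence of the edges: distributing the product over the two states of every edge gives the
    sum over all graphs. *)
Lemma er_expect_prod (h : edge k -> bool -> R) :
  \sum_G er_weight p G * \prod_e h e (e \in G) =
  \prod_e (p * h e true + (1 - p) * h e false).
Proof.
pose F e (b : bool) := (if b then p else 1 - p) * h e b.
transitivity (\prod_e \sum_(b : bool) F e b); last first.
  by apply: eq_bigr => e _; rewrite big_bool.
rewrite bigA_distr_bigA (reindex (fun f : {ffun edge k -> bool} =>
   [set e | f e]%SET)) /=; last first.
  exists (fun G : {set edge k} => [ffun e => e \in G]) => [f _|G _].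
    by apply/ffunP => e; rewrite ffunE inE.
  by apply/setP => e; rewrite inE ffunE.
apply: eq_bigr => f _; rewrite /er_weight -big_split; apply: eq_bigr => e _ /=.
by rewrite inE.
Qed.

(** For [t^2 > 1/2] both [t] and [- t] are at most [2 t^2]. Otherwise [e^t <= 1 / (1 - t)] gives
    [cosh t <= 1 / (1 - t^2) <= 1 + 2 t^2]. *)
Lemma cosh_le (t : R) : (expR t + expR (- t)) / 2 <= expR (2 * t ^+ 2).
Proof.
have [t2|t2] := lerP (t ^+ 2) 2^-1; last first.
  have h1 : expR t <= expR (2 * t ^+ 2).
    by rewrite ler_expR; have := sqr_ge0 (t - 1); rewrite sqrrB; lra.
  have h2 : expR (- t) <= expR (2 * t ^+ 2).
    by rewrite ler_expR; have := sqr_ge0 (t + 1); rewrite sqrrD; lra.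
  lra.
apply: le_trans (expR_ge1Dx _).
have h1 : expR t * (1 - t) <= 1.
  rewrite -[leRHS]expR0 -(subrr t) expRD ler_pM2l ?expR_gt0 //.
  exact: expR_ge1Dx.
have h2 : expR (- t) * (1 + t) <= 1.
  rewrite -[leRHS]expR0 -(addNr t) expRD ler_pM2l ?expR_gt0 //.
  exact: expR_ge1Dx.
have t1 : -1 < t < 1 by apply/andP; split; nra.
case/andP: t1 => t1 t1'.
have h3 : (1 - t ^+ 2) * ((expR t + expR (- t)) / 2) <= 1.
  have := ler_wpM2r (_ : 0 <= 1 + t) h1; have := ler_wpM2r (_ : 0 <= 1 - t) h2.
  rewrite expr2; move=> /(_ ltac:(lra)) e1 /(_ ltac:(lra)) e2; lra.
have u0 : 0 < 1 - t ^+ 2 by lra.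
rewrite -(ler_pM2l u0); apply: le_trans h3 _.
have := sqr_ge0 t; set u := t ^+ 2 in t2 u0 *; nra.
Qed.

(** Symmetrization: [b], the transform of an independent copy at [- t], is at least 1 since the mean
    is 0. Hence [a <= a b], the transform of a difference with values in [{-1, 0, 1}], which is a
    convex combination of 1 and [cosh t]. *)
Lemma centred_bernoulli_mgf (t : R) :
  p * expR (t * (1 - p)) + (1 - p) * expR (t * (0 - p)) <= expR (2 * t ^+ 2).
Proof.
case/andP: p01 => p0 p1; apply: le_trans (cosh_le t).
set a := _ + _; pose b := p * expR (- (t * (1 - p))) + (1 - p) * expR (- (t * (0 - p))).
have a0 : 0 <= a by rewrite addr_ge0 // mulr_ge0 ?expR_ge0 // subr_ge0.
have b1 : 1 <= b.
  have h1 := ler_wpM2l p0 (expR_ge1Dx (- (t * (1 - p)))).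
  have h2 := ler_wpM2l (_ : 0 <= 1 - p) (expR_ge1Dx (- (t * (0 - p)))).
  by have {}h2 := h2 ltac:(lra); rewrite /b; lra.
apply: le_trans (ler_peMr a0 b1) _.
set c := (_ + _) / 2.
have c1 : 1 <= c.
  have := expR_ge1Dx t; have := expR_ge1Dx (- t); rewrite /c; lra.
have -> : a * b = p ^+ 2 + (1 - p) ^+ 2 + 2 * (p * (1 - p)) * c.
  have e1 : expR (t * (1 - p)) * expR (- (t * (1 - p))) = 1.
    by rewrite -expRD subrr expR0.
  have e2 : expR (t * (0 - p)) * expR (- (t * (0 - p))) = 1.
    by rewrite -expRD subrr expR0.
  have e3 : expR (t * (1 - p)) * expR (- (t * (0 - p))) = expR t.
    by rewrite -expRD; congr expR; ring.
  have e4 : expR (t * (0 - p)) * expR (- (t * (1 - p))) = expR (- t).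
    by rewrite -expRD; congr expR; ring.
  transitivity (p ^+ 2 * (expR (t * (1 - p)) * expR (- (t * (1 - p)))) +
    (1 - p) ^+ 2 * (expR (t * (0 - p)) * expR (- (t * (0 - p)))) +
    p * (1 - p) * (expR (t * (1 - p)) * expR (- (t * (0 - p))) +
                   expR (t * (0 - p)) * expR (- (t * (1 - p))))).
    by rewrite /a /b; ring.
  by rewrite e1 e2 e3 e4 /c; field.
have : 0 <= (p ^+ 2 + (1 - p) ^+ 2) * (c - 1).
  by rewrite mulr_ge0 ?subr_ge0 // addr_ge0 ?sqr_ge0.
rewrite !expr2; lra.
Qed.

(** Exponential Markov inequality, followed by independence and the one-edge estimate. *)
Lemma er_chernoff (a : edge k -> R) (lam T : R) : 0 <= lam ->
  er_prob p (fun G => T < \sum_e ((e \in G)%:R - p) * a e) <=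
  expR (2 * lam ^+ 2 * (\sum_e a e ^+ 2) - lam * T).
Proof.
move=> lam0; pose S G := \sum_e ((e \in G)%:R - p) * a e.
apply: le_trans (_ : \sum_G er_weight p G * expR (lam * S G - lam * T) <= _).
  rewrite /er_prob big_mkcond; apply: ler_sum => G _.
  case: ifP => [TS|_]; last by rewrite mulr_ge0 ?er_weight_ge0 ?expR_ge0.
  rewrite -[leLHS]mulr1 ler_wpM2l ?er_weight_ge0 // -expR0 ler_expR -mulrBr.
  by rewrite mulr_ge0 // subr_ge0 ltW.
under eq_bigr => G _ do rewrite expRD mulrA.
rewrite -mulr_suml expRD ler_wpM2r ?expR_ge0 //.
have SE G : expR (lam * S G) =
    \prod_e expR (lam * a e * ((nat_of_bool (e \in G))%:R - p)).
  by rewrite -expR_sum mulr_sumr; congr expR; apply: eq_bigr => e _; ring.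
under eq_bigr => G _ do rewrite SE.
rewrite (er_expect_prod (fun e (b : bool) => expR (lam * a e * (b%:R - p)))).
rewrite mulr_sumr expR_sum; apply: ler_prod => e _; apply/andP; split.
  by case/andP: p01 => p0 p1; rewrite addr_ge0 // mulr_ge0 ?expR_ge0 ?subr_ge0.
apply: le_trans (centred_bernoulli_mgf _) _.
by rewrite ler_expR exprMn mulrA.
Qed.

End ErdosRenyi.

(** * First moment bound for the clique number *)

Section Cliques.
Context (R : realType) (k : nat) (p : R).
Hypothesis p01 : 0 <= p <= 1.

Lemma card_edges_in (S : {set 'I_k}) :
  #|[set e : edge k | val e \subset S]%SET| = 'C(#|S|, 2).
Proof.
rewrite -cards_draws -(card_imset _ val_inj); apply: eq_card => A.
rewrite inE; apply/imsetP/andP => [[e]|[AS A2]].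
  by rewrite inE => eS ->; split=> //; exact: (valP e).
by exists (Sub A A2 : edge k); rewrite ?inE.
Qed.

Lemma clique_edges (G : graph k) (S : {set 'I_k}) :
  {in S &, forall u v, u != v -> edge_rel G u v} ->
  [set e : edge k | val e \subset S]%SET \subset G.
Proof.
move=> clq; apply/fintype.subsetP => e; rewrite inE => /fintype.subsetP eS.
have /cards2P[u [v [uv ev]]] := valP e.
have /existsP[e' /andP[e'G /eqP e'v]] : edge_rel G u v.
  by apply: clq => //; apply: eS; rewrite ev !inE eqxx ?orbT.
by rewrite (_ : e = e') //; apply: val_inj; rewrite e'v.
Qed.

(** A clique that is too large contains one with exactly [omega.+1] vertices, whose
    ['C(omega.+1, 2)] edges are all present. The number of candidate sets is at most
    [k ^ omega.+1]. *)
Lemma clique_prob (omega : nat) :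
  er_prob p (fun G : graph k => ~~ `[< clique_le G omega >]) <=
  k%:R ^+ omega.+1 * p ^+ 'C(omega.+1, 2).
Proof.
have p0 : 0 <= p by case/andP: p01.
apply: le_trans (er_prob_exists p01 (Q := fun S : {set 'I_k} => #|S| == omega.+1)
  (A := fun S (G : graph k) => [set e : edge k | val e \subset S]%SET \subset G) _) _.
  move=> G /asboolPn/existsNP[K] /not_implyP[clq /negP].
  rewrite -ltnNge => cardK.
  have : (0 < #|[set A : {set 'I_k} | A \subset K & #|A| == omega.+1]%SET|)%N.
    by rewrite cards_draws bin_gt0.
  case/card_gt0P => S; rewrite inE => /andP[/fintype.subsetP SK Sm]; exists S => //.
  by apply: clique_edges => u v uS vS; apply: clq; exact: SK.
rewrite (eq_bigr (fun=> p ^+ 'C(omega.+1, 2))); last first.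
  by move=> S /eqP Sm; rewrite er_prob_supset card_edges_in Sm.
rewrite sumr_const -[leLHS]mulr_natl ler_wpM2r ?exprn_ge0 // -natrX ler_nat.
rewrite -[X in (X <= _)%N]cardsE card_draws card_ord.
apply: leq_trans (_ : k ^_ omega.+1 <= _)%N.
  by rewrite -bin_ffact leq_pmulr ?fact_gt0.
rewrite ffact_prod -[in leqRHS](card_ord omega.+1) -prod_nat_const.
by apply: leq_prod => i _; exact: leq_subr.
Qed.

End Cliques.

(** * Norm of the centred adjacency matrix *)

Section CentredForm.
Context (R : realType) (k : nat) (p : R).
Hypothesis p01 : 0 <= p <= 1.
Implicit Types (G : graph k) (x y : 'I_k -> R) (z : 'I_k * 'I_k) (e : edge k).

Definition pair_edge z e := ((z.1 < z.2)%N && ([set z.1; z.2]%SET == val e)).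

Lemma edge_pair e : exists z0, pair_edge^~ e =1 pred1 z0.
Proof.
have /cards2P[u [v [uv ev]]] := valP e.
wlog ltuv : u v uv ev / (u < v)%N.
  move=> H; have [uv'|vu|/val_inj uv'] := ltngtP u v; first exact: (H u v).
    by apply: (H v u) => //; [rewrite eq_sym | rewrite ev finset.setUC].
  by rewrite uv' eqxx in uv.
exists (u, v) => -[a b]; rewrite /pair_edge /= ev.
apply/andP/eqP => [[ab /eqP abuv]|[-> ->]]; last by rewrite eqxx.
have : a \in [set u; v]%SET by rewrite -abuv !inE eqxx.
have : b \in [set u; v]%SET by rewrite -abuv !inE eqxx orbT.
by rewrite !inE => /orP[]/eqP bE /orP[]/eqP aE;
  move: ab; rewrite aE bE ?ltnn //; case: ltngtP ltuv.
Qed.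

Lemma sum_pairs_edges (F : 'I_k * 'I_k -> R) :
  \sum_(z : 'I_k * 'I_k | (z.1 < z.2)%N) F z = \sum_e \sum_(z | pair_edge z e) F z.
Proof.
rewrite (exchange_big_dep (fun z : 'I_k * 'I_k => (z.1 < z.2)%N)) /=; last first.
  by move=> e z _ /andP[].
apply: eq_bigr => z zlt.
have ne : #|[set z.1; z.2]%SET| == 2%N.
  by rewrite cards2 neq_ltn zlt.
rewrite (big_pred1 (Sub [set z.1; z.2]%SET ne : edge k)) // => e.
by rewrite /pair_edge zlt -val_eqE eq_sym.
Qed.

(** The strictly upper triangular part, in which every edge occurs once, so that the summands are
    independent. Two arguments are kept for the net argument. *)
Definition upper_form G x y :=
  \sum_(z : 'I_k * 'I_k | (z.1 < z.2)%N) ((edge_rel G z.1 z.2)%:R - p) * x z.1 * y z.2.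

Definition edge_coef x y e := \sum_(z | pair_edge z e) x z.1 * y z.2.

Lemma upper_formE G x y :
  upper_form G x y = \sum_e ((e \in G)%:R - p) * edge_coef x y e.
Proof.
rewrite /upper_form sum_pairs_edges; apply: eq_bigr => e _.
rewrite mulr_sumr; apply: eq_bigr => z /andP[_ /eqP ze].
rewrite -mulrA; congr ((_ - _) * _); congr (nat_of_bool _)%:R.
apply/existsP/idP => [[e' /andP[e'G /eqP e'z]]|eG].
  by rewrite (_ : e = e') //; apply: val_inj; rewrite e'z.
by exists e; rewrite eG ze eqxx.
Qed.

(** Each [edge_coef] has a single term, so the squares form part of the expanded product on the
    right. *)
Lemma sum_edge_coef_sqr x y :
  \sum_e edge_coef x y e ^+ 2 <= (\sum_i x i ^+ 2) * (\sum_i y i ^+ 2).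
Proof.
have -> : \sum_e edge_coef x y e ^+ 2 =
    \sum_(z : 'I_k * 'I_k | (z.1 < z.2)%N) x z.1 ^+ 2 * y z.2 ^+ 2.
  rewrite sum_pairs_edges; apply: eq_bigr => e _; rewrite /edge_coef.
  have [z0 ez0] := edge_pair e.
  by rewrite !(big_pred1 z0 ez0) exprMn.
rewrite big_distrlr pair_big /= [leRHS](bigID (fun z : 'I_k * 'I_k => (z.1 < z.2)%N)) /=.
by rewrite lerDl sumr_ge0 // => z _; rewrite mulr_ge0 ?sqr_ge0.
Qed.

Lemma centred_form_upper G x :
  \sum_u \sum_(v | v != u) ((edge_rel G u v)%:R - p) * x u * x v =
  2 * upper_form G x x.
Proof.
rewrite pair_big_dep /= (bigID (fun z : 'I_k * 'I_k => (z.1 < z.2)%N)) /=.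
have -> : 2 * upper_form G x x = upper_form G x x + upper_form G x x by ring.
congr (_ + _).
  by apply: eq_bigl => z; rewrite neq_ltn andb_orl ltnNge; case: ltngtP.
rewrite (reindex_inj (h := fun z : 'I_k * 'I_k => (z.2, z.1))) /=; last first.
  by move=> [a b] [c d] [-> ->].
rewrite /upper_form; apply: eq_big => [z|z _].
  by rewrite -leqNgt ltn_neqAle -val_eqE eq_sym.
by rewrite edge_rel_sym mulrAC.
Qed.

Lemma upper_formDl G x x' y :
  upper_form G (fun i => x i + x' i) y = upper_form G x y + upper_form G x' y.
Proof. by rewrite -big_split; apply: eq_bigr => z _ /=; ring. Qed.

Lemma upper_formDr G x y y' :
  upper_form G x (fun i => y i + y' i) = upper_form G x y + upper_form G x y'.
Proof. by rewrite -big_split; apply: eq_bigr => z _ /=; ring. Qed.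

Lemma upper_formZ G a b x y :
  upper_form G (fun i => a * x i) (fun i => b * y i) = a * b * upper_form G x y.
Proof. by rewrite mulr_sumr; apply: eq_bigr => z _; ring. Qed.

Let norm2 x : R := Num.sqrt (\sum_i x i ^+ 2).

Let norm2_sqr x : norm2 x ^+ 2 = \sum_i x i ^+ 2.
Proof. by rewrite sqr_sqrtr // sumr_ge0 // => i _; exact: sqr_ge0. Qed.

Let coord_le_norm2 x i : `|x i| <= norm2 x.
Proof.
rewrite -sqrtr_sqr ler_wsqrtr //.
by rewrite (bigD1 i) //= lerDl sumr_ge0 // => j _; exact: sqr_ge0.
Qed.

Let norm2_le x c : 0 <= c -> \sum_i x i ^+ 2 <= c ^+ 2 -> norm2 x <= c.
Proof. by move=> c0 h; rewrite -[c]ger0_norm // -sqrtr_sqr ler_wsqrtr. Qed.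

(** Every entry of the matrix is at most 1 in absolute value, and every coordinate is at most the
    norm. This starts the contraction below and bounds the norm for small [k]. *)
Lemma upper_form_trivial G x y :
  `|upper_form G x y| <= k%:R ^+ 2 * (norm2 x * norm2 y).
Proof.
case/andP: p01 => p0 p1.
apply: le_trans (ler_norm_sum _ _ _) _.
apply: le_trans (_ : \sum_(z : 'I_k * 'I_k) norm2 x * norm2 y <= _); last first.
  by rewrite sumr_const card_prod card_ord -[leLHS]mulr_natl natrM expr2.
rewrite big_mkcond; apply: ler_sum => z _; case: ifP => _; last by rewrite mulr_ge0 ?sqrtr_ge0.
rewrite -mulrA normrM -[leRHS]mul1r; apply: ler_pM => //.
  by rewrite ler_norml; case: (edge_rel _ _ _); rewrite ?mulr1n ?mulr0n; apply/andP; split; lra.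
by rewrite normrM ler_pM.
Qed.

(** Coordinates of a vector of norm [4 sqrt k] are at most [4 k], so the net lives in a finite
    type. *)
Let N := (4 * k)%N.

Definition net (n : {ffun 'I_k -> 'I_N.+1}) := (\sum_i n i ^ 2 <= 16 * k)%N.

Definition net_vec (n : {ffun 'I_k -> 'I_N.+1}) : 'I_k -> R := fun i => (n i)%:R.

(** On the net [\sum_i n i <= \sum_i n i ^ 2 <= 16 k], so each point has weight at least 1 on the
    right of the next display. The total weight factors into [k] geometric sums, each at most 2. *)
Lemma card_net : (#|net|%:R : R) <= 2 ^+ (17 * k).
Proof.
rewrite -sum1_card natr_sum.
apply: le_trans (_ : \sum_(n : {ffun 'I_k -> 'I_N.+1})
    2 ^+ (16 * k) * \prod_i (2^-1 : R) ^+ n i <= _).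
  rewrite big_mkcond; apply: ler_sum => n _; case: ifP => [nn|_]; last first.
    by rewrite mulr_ge0 ?exprn_ge0 // prodr_ge0 // => i _; rewrite exprn_ge0.
  rewrite prodrXr exprVn ler_pdivlMr ?exprn_gt0 // mul1r ler_eXn2l ?ltr1n //.
  by apply: leq_trans nn; apply: leq_sum => i _; case: (nat_of_ord _) => // j; rewrite leq_pmulr.
rewrite -mulr_sumr (_ : (17 * k = 16 * k + k)%N); last by rewrite -mulSnr.
rewrite exprD ler_wpM2l ?exprn_ge0 //.
rewrite -(bigA_distr_bigA (fun _ (j : 'I_N.+1) => (2^-1 : R) ^+ j)).
rewrite prodr_const card_ord; apply: lerXn2r; rewrite ?nnegrE //.
  by apply: sumr_ge0 => j _; rewrite exprn_ge0.
have geom M : \sum_(j < M) (2^-1 : R) ^+ j = 2 - 2 * 2^-1 ^+ M.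
  elim: M => [|M IH]; first by rewrite big_ord0 expr0 mulr1 subrr.
  by rewrite big_ord_recr /= IH exprS; field.
by rewrite geom gerBl mulr_ge0 // exprn_ge0.
Qed.

(* Rounding a vector of norm [4 sqrt k] down to the net leaves a remainder of
   norm at most [sqrt k]; the two remainders thus reproduce half of the
   inequality, which [bound_contraction] absorbs. *)
Lemma upper_form_le_net G (D : R) : (0 < k)%N -> 0 < D ->
  (forall n m, net n -> net m ->
    `|upper_form G (net_vec n) (net_vec m)| <= 16 * k%:R * D) ->
  forall x y, (forall i, 0 <= x i) -> (forall i, 0 <= y i) ->
  `|upper_form G x y| <= 2 * D * (norm2 x * norm2 y).
Proof.
move=> k0 D0 hnet x y x0 y0.
have kp : 0 < (k%:R : R) by rewrite ltr0n.
pose nonneg (w : ('I_k -> R) * ('I_k -> R)) :=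
  (forall i, 0 <= w.1 i) /\ (forall i, 0 <= w.2 i).
suff contr : forall w, nonneg w ->
    `|upper_form G w.1 w.2| <= D / (1 - 2^-1) * (norm2 w.1 * norm2 w.2).
  have -> : 2 * D = D / (1 - 2^-1) by field.
  exact: contr (x, y) (conj x0 y0).
apply: (@bound_contraction R _ nonneg (fun w => `|upper_form G w.1 w.2|)
  (fun w => norm2 w.1 * norm2 w.2) D 2^-1 (k%:R ^+ 2)) => //.
- by apply/andP; split; lra.
- by rewrite exprn_gt0.
- by move=> w _; exact: upper_form_trivial.
move=> K K0 hK [{}x {}y] [/= {}x0 {}y0].
have := hK (x, y) (conj x0 y0) => /=.
have [a0|a0] := eqVneq (norm2 x) 0; first by rewrite a0 !mul0r !mulr0.
have [b0|b0] := eqVneq (norm2 y) 0; first by rewrite b0 !mulr0.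
move=> _.
have rnd w : (forall i, 0 <= w i) -> norm2 w != 0 ->
    exists n : {ffun 'I_k -> 'I_N.+1}, exists r : 'I_k -> R,
    [/\ net n, forall i, 0 <= r i, norm2 r <= norm2 w / 4 &
       w = fun i => norm2 w / (4 * Num.sqrt k%:R) * net_vec n i + r i].
  move=> w0 nw0; set a := norm2 w in nw0 *; pose c := 4 * Num.sqrt (k%:R : R).
  have ap : 0 < a by rewrite lt_neqAle eq_sym nw0 sqrtr_ge0.
  have c0 : 0 < c by rewrite mulr_gt0 // sqrtr_gt0.
  have c2 : c ^+ 2 = 16 * k%:R by rewrite exprMn sqr_sqrtr; [ring|exact: ltW].
  pose s i := c / a * w i.
  have s0 i : 0 <= s i by rewrite mulr_ge0 // divr_ge0 // ltW.
  have tr i : (Num.truncn (s i))%:R <= s i < (Num.truncn (s i)).+1%:R.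
    exact: truncn_itv.
  have trN i : (Num.truncn (s i) <= N)%N.
    rewrite -(ler_nat R); case/andP: (tr i) => /le_trans + _; apply.
    have : s i <= c.
      rewrite /s mulrAC ler_pdivrMr // ler_wpM2l ?(ltW c0) //.
      by apply: le_trans (coord_le_norm2 w i); exact: ler_norm.
    move=> /le_trans; apply; rewrite /c /N natrM ler_wpM2l //.
    rewrite -[leRHS]ger0_norm // -sqrtr_sqr ler_wsqrtr // -natrX ler_nat.
    by rewrite leq_pmulr.
  pose n : {ffun 'I_k -> 'I_N.+1} := [ffun i => inord (Num.truncn (s i))].
  have nE i : net_vec n i = (Num.truncn (s i))%:R.
    by rewrite /net_vec ffunE inordK ?ltnS.
  exists n; exists (fun i => w i - a / c * net_vec n i).
  have wE i : w i = a / c * s i by rewrite /s; field; rewrite nw0 gt_eqF.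
  have rE i : w i - a / c * net_vec n i = a / c * (s i - (Num.truncn (s i))%:R).
    by rewrite nE [in LHS]wE mulrBr.
  split.
  - rewrite /net -(ler_nat R) natr_sum natrM -c2.
    apply: le_trans (_ : \sum_i s i ^+ 2 <= _).
      apply: ler_sum => i _; rewrite natrX ler_sqr ?nnegrE //.
      by have := nE i; rewrite /net_vec => ->; case/andP: (tr i).
    under eq_bigr => i _ do rewrite exprMn.
    by rewrite -mulr_sumr -norm2_sqr -/a -exprMn divfK.
  - move=> i; rewrite rE mulr_ge0 ?divr_ge0 ?(ltW ap) ?(ltW c0) // subr_ge0.
    by case/andP: (tr i).
  - apply: norm2_le; first by rewrite divr_ge0 // ltW.
    apply: le_trans (_ : \sum_(i < k) (a / c) ^+ 2 <= _).
      apply: ler_sum => i _; rewrite rE exprMn -[leRHS]mulr1 ler_wpM2l ?sqr_ge0 //.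
      case/andP: (tr i) => l1; rewrite -natr1 => l2.
      by apply: exprn_ile1; lra.
    rewrite sumr_const card_ord -[leLHS]mulr_natl expr_div_n c2 le_eqVlt.
    by apply/orP; left; apply/eqP; field; rewrite gt_eqF.
  - by apply/funext => i; rewrite addrC subrK.
have [n [r [nn r0 rle xE]]] := rnd x x0 a0.
have [m [t [nm t0 tle yE]]] := rnd y y0 b0.
set a := norm2 x in a0 rle xE *; set b := norm2 y in b0 tle yE *.
pose c := 4 * Num.sqrt (k%:R : R).
have c0 : 0 < c by rewrite mulr_gt0 // sqrtr_gt0.
have c2 : c ^+ 2 = 16 * k%:R by rewrite exprMn sqr_sqrtr; [ring|exact: ltW].
have ap : 0 <= a := sqrtr_ge0 _. have bp : 0 <= b := sqrtr_ge0 _.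
pose x' i := a / c * net_vec n i; pose y' i := b / c * net_vec m i.
have x'0 i : 0 <= x' i by rewrite mulr_ge0 // divr_ge0 // ltW.
(* The three terms contribute [D], [K / 4] and [K / 4], each times the product of the norms. *)
have -> : upper_form G x y =
    upper_form G x' y' + upper_form G x' t + upper_form G r y.
  by rewrite [in LHS]xE upper_formDl [in X in X + _ = _]yE upper_formDr.
have h1 : `|upper_form G x' y'| <= D * (a * b).
  rewrite upper_formZ normrM ger0_norm; last by rewrite mulr_ge0 // divr_ge0 // ltW.
  apply: le_trans (ler_wpM2l _ (hnet n m nn nm)) _.
    by rewrite mulr_ge0 // divr_ge0 // ltW.
  rewrite -c2 le_eqVlt; apply/orP; left; apply/eqP; field.
  by rewrite gt_eqF.
(* Rounding down a nonnegative vector decreases every coordinate; this is where the sign condition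
   is used. *)
have x'le : norm2 x' <= a.
  apply: ler_wsqrtr; apply: ler_sum => i _; rewrite ler_sqr ?nnegrE //.
  by have -> : x i = x' i + r i; [rewrite [in LHS]xE | rewrite lerDl].
have h2 : `|upper_form G x' t| <= K * (a * (b / 4)).
  apply: le_trans (hK (x', t) (conj x'0 t0)) _.
  by rewrite ler_wpM2l ?(ltW K0) // ler_pM ?sqrtr_ge0.
have h3 : `|upper_form G r y| <= K * (a / 4 * b).
  apply: le_trans (hK (r, y) (conj r0 y0)) _.
  by rewrite ler_wpM2l ?(ltW K0) // ler_pM ?sqrtr_ge0.
have := ler_normD (upper_form G x' y' + upper_form G x' t) (upper_form G r y).
have := ler_normD (upper_form G x' y') (upper_form G x' t).
lra.
Qed.

(** With [x = xp - xn], the four pieces add up to at most [2 D (a + b)^2 <= 4 D (a^2 + b^2)]; the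
    two triangles of the matrix double this. *)
Lemma centred_form_le_net G (D : R) : (0 < k)%N -> 0 < D ->
  (forall n m, net n -> net m ->
    `|upper_form G (net_vec n) (net_vec m)| <= 16 * k%:R * D) ->
  centred_form_le G p (8 * D).
Proof.
move=> k0 D0 hnet x; rewrite centred_form_upper normrM ger0_norm //.
pose xp i := Num.max (x i) 0; pose xn i := Num.max (- x i) 0.
have xp0 i : 0 <= xp i by rewrite le_max lexx orbT.
have xn0 i : 0 <= xn i by rewrite le_max lexx orbT.
have xE i : x i = xp i - xn i /\ x i ^+ 2 = xp i ^+ 2 + xn i ^+ 2.
  rewrite /xp /xn; have /orP[h|h] := le_total 0 (x i).
    by rewrite max_l // max_r ?oppr_le0 // subr0 expr0n addr0.
  by rewrite max_r // max_l ?oppr_ge0 // sub0r opprK expr0n add0r sqrrN.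
have -> : upper_form G x x = upper_form G xp xp - upper_form G xp xn -
    upper_form G xn xp + upper_form G xn xn.
  rewrite -!sumrB -big_split; apply: eq_bigr => z _ /=.
  by rewrite (xE z.1).1 (xE z.2).1; ring.
have bnd := upper_form_le_net k0 D0 hnet.
have -> : \sum_i x i ^+ 2 = norm2 xp ^+ 2 + norm2 xn ^+ 2.
  by rewrite !norm2_sqr -big_split; apply: eq_bigr => i _; rewrite (xE i).2.
have h1 := bnd _ _ xp0 xp0; have h2 := bnd _ _ xp0 xn0.
have h3 := bnd _ _ xn0 xp0; have h4 := bnd _ _ xn0 xn0.
set a := norm2 xp in h1 h2 h3 *; set b := norm2 xn in h2 h3 h4 *.
have amgm : 0 <= D * (a - b) ^+ 2 by rewrite mulr_ge0 ?sqr_ge0 // ltW.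
move: h1 h2 h3 h4; rewrite !ler_norml.
move=> /andP[h1 h1'] /andP[h2 h2'] /andP[h3 h3'] /andP[h4 h4'].
set u := _ + upper_form G xn xn.
have : `|u| <= 2 * D * (a + b) ^+ 2 by rewrite ler_norml /u; apply/andP; split; lra.
lra.
Qed.

(** Chernoff with parameter [1 / sqrt k]: the quadratic term is at most [2 / k * 256 k^2 = 512 k]
    and the linear one is [16 * 35 k = 560 k]. The factor 2 accounts for both signs. *)
Lemma net_point_tail n m : (0 < k)%N -> net n -> net m ->
  er_prob p (fun G => 16 * k%:R * (35 * Num.sqrt k%:R) <
    `|upper_form G (net_vec n) (net_vec m)|) <= 2 * expR (- 48 * k%:R).
Proof.
move=> k0 nn nm; set T := 16 * _ * _.
have kp : 0 < (k%:R : R) by rewrite ltr0n.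
have r0 : 0 < Num.sqrt (k%:R : R) by rewrite sqrtr_gt0.
pose a := edge_coef (net_vec n) (net_vec m).
have net2 (l : {ffun 'I_k -> 'I_N.+1}) : net l -> \sum_i net_vec l i ^+ 2 <= 16 * k%:R.
  by rewrite /net -(ler_nat R) natr_sum natrM; under eq_bigr => i _ do rewrite natrX.
have a2 : \sum_e a e ^+ 2 <= 256 * k%:R ^+ 2.
  apply: le_trans (sum_edge_coef_sqr _ _) _.
  have -> : 256 * k%:R ^+ 2 = (16 * k%:R) * (16 * k%:R) :> R by ring.
  by apply: ler_pM; rewrite ?net2 // sumr_ge0 // => i _; exact: sqr_ge0.
have tail b : \sum_e b e ^+ 2 = \sum_e a e ^+ 2 ->
    er_prob p (fun G => T < \sum_e ((e \in G)%:R - p) * b e) <= expR (- 48 * k%:R).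
  move=> ba; apply: le_trans (er_chernoff p01 _ _ (_ : 0 <= (Num.sqrt k%:R)^-1)) _.
    by rewrite invr_ge0 ltW.
  rewrite ler_expR ba exprVn sqr_sqrtr ?(ltW kp) //.
  have -> : (Num.sqrt k%:R)^-1 * T = 560 * k%:R by rewrite /T; field; rewrite gt_eqF.
  have := ler_wpM2l (_ : 0 <= 2 * (k%:R : R)^-1) a2.
  rewrite mulr_ge0 ?invr_ge0 // => /(_ isT).
  have -> : 2 * k%:R^-1 * (256 * k%:R ^+ 2) = 512 * k%:R :> R by field; rewrite gt_eqF.
  lra.
have aN : \sum_e (- a e) ^+ 2 = \sum_e a e ^+ 2.
  by apply: eq_bigr => e _; rewrite sqrrN.
apply: le_trans (er_prob_mono p01 _) _; last first.
  apply: le_trans (er_prob_or p01 _ _) _.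
  by rewrite mulr_natl mulr2n; exact: lerD (tail a erefl) (tail (fun e => - a e) aN).
move=> G /=; rewrite upper_formE -/a lter_normr => /orP[->//|h].
apply/orP; right; apply: lt_le_trans h _; rewrite -sumrN le_eqVlt.
by apply/orP; left; apply/eqP; apply: eq_bigr => e _; rewrite mulrN.
Qed.

(** Union bound over pairs of net points: there are at most [2 ^ (34 k) <= e ^ (34 k)], the factor 2
    is at most [e ^ k], and [34 + 1 - 48 < -1]. Here [280 = 8 * 35]. *)
Lemma centred_form_prob : (0 < k)%N ->
  er_prob p (fun G => ~~ `[< centred_form_le G p (280 * Num.sqrt k%:R) >]) <=
  expR (- k%:R).
Proof.
move=> k0; have kp : 0 < (k%:R : R) by rewrite ltr0n.
pose bad n m G := 16 * k%:R * (35 * Num.sqrt k%:R) <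
  `|upper_form G (net_vec n) (net_vec m)|.
pose bad1 n G := [exists m, net m && bad n m G].
apply: le_trans (er_prob_exists p01 (Q := net) (A := bad1) _) _.
  move=> G /asboolPn nc; apply: contrapT => nbad; apply: nc.
  have -> : 280 * Num.sqrt k%:R = 8 * (35 * Num.sqrt k%:R) :> R by ring.
  apply: centred_form_le_net => //; first by rewrite mulr_gt0 // sqrtr_gt0.
  move=> n m nn nm; rewrite leNgt; apply/negP => nb; apply: nbad.
  by exists n => //; apply/existsP; exists m; rewrite nm.
apply: le_trans (_ : \sum_(n | net n) \sum_(m | net m) 2 * expR (- 48 * k%:R) <= _).
  apply: ler_sum => n nn.
  apply: le_trans (er_prob_exists p01 (Q := net) (A := bad n) _) _.
    by move=> G /existsP[m /andP[nm bm]]; exists m.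
  by apply: ler_sum => m nm; exact: net_point_tail.
rewrite !sumr_const -[leLHS]mulr_natl -[X in #|_|%:R * X]mulr_natl.
have e2 : 2 <= expR 1 :> R by have := expR_ge1Dx (1 : R).
have e17 : #|net|%:R <= expR (17 * k%:R) :> R.
  apply: le_trans card_net _; rewrite -[_ * k%:R]mulr1 -natrM expRM_natl.
  by apply: lerXn2r; rewrite ?nnegrE ?expR_ge0.
have e1 : 2 <= expR k%:R :> R.
  by apply: le_trans e2 _; rewrite ler_expR ler1n.
apply: le_trans (_ : expR (17 * k%:R) * (expR (17 * k%:R) *
    (expR k%:R * expR (- 48 * k%:R))) <= _).
  rewrite !ler_pM ?mulr_ge0 ?expR_ge0 //.
by rewrite -!expRD ler_expR; lra.
Qed.

End CentredForm.

(** * Tail of the norm *)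

Section NormTail.
Context (R : realType) (q : R).
Hypothesis hq : -1 < q < 1.

Let q01 : 0 <= `|q| <= 1.
Proof. by rewrite normr_ge0 /= ltW // ltr_norml. Qed.

Let r0 : 0 < Num.sqrt (1 - q).
Proof. by rewrite sqrtr_gt0 subr_gt0; case/andP: hq. Qed.

(** For [w] just above [4 ln k / beta] the first moment exponent [(w + 1) (ln k - beta w / 2)] is at
    most [- (w + 1) ln k], hence at most [- (4 / beta) ln^2 k]. *)
Lemma clique_tail : exists C c : R, [/\ 0 < C, 0 < c &
  forall k : nat, (2 <= k)%N -> exists2 omega : nat, omega%:R <= C * ln k%:R &
    er_prob `|q| (fun G : graph k => ~~ `[< clique_le G omega >]) <=
    expR (- c * ln k%:R ^+ 2)].
Proof.
(* Bounding the edge probability from below keeps its logarithm meaningful at [q = 0]. *)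
pose rho : R := Num.max `|q| 2^-1.
have rho0 : 0 < rho by rewrite lt_max invr_gt0 ltr0n orbT.
have rho1 : rho < 1 by rewrite gt_max ltr_norml hq /=; lra.
pose beta := - ln rho.
have beta0 : 0 < beta by rewrite oppr_gt0 ln_lt0 // rho0.
have l2 : 0 < ln (2 : R) by rewrite ln_gt0 // ltr1n.
(* The summand [(ln 2)^-1] absorbs the successor in [w], since [ln k >= ln 2]. *)
exists (4 / beta + (ln 2)^-1), (4 / beta); split.
- by rewrite addr_gt0 ?divr_gt0 ?invr_gt0.
- by rewrite divr_gt0.
move=> k k2; set l := ln (k%:R : R).
have kp : 0 < (k%:R : R) by rewrite ltr0n (leq_trans _ k2).
have l0 : ln 2 <= l by rewrite ler_ln ?posrE // ler_nat.
have lp : 0 < l by exact: lt_le_trans l0.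
have y0 : 0 <= 4 / beta * l by rewrite mulr_ge0 ?divr_ge0 // ltW.
have /andP[t1 t2] := truncn_itv y0.
exists (Num.truncn (4 / beta * l)).+1.
  rewrite -[leLHS]natr1 [leRHS]mulrDl lerD //.
  by rewrite mulrC ler_pdivlMr // mul1r.
set w := (Num.truncn _).+1 in t2 *.
apply: le_trans (clique_prob k q01 w) _.
apply: le_trans (_ : k%:R ^+ w.+1 * rho ^+ 'C(w.+1, 2) <= _).
  by rewrite ler_wpM2l ?exprn_ge0 ?ler0n // lerXn2r ?nnegrE ?(ltW rho0) // le_max lexx.
have binE : ('C(w.+1, 2))%:R = w.+1%:R * w%:R / 2 :> R.
  have /(congr1 (fun n => n%:R : R)) := mul_bin_diag w.+1 1.
  by rewrite bin1 !natrM => ->; field.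
rewrite -[X in X ^+ w.+1](lnK (_ : k%:R \in Num.pos)) ?posrE //.
rewrite -[X in _ * X ^+ _](lnK (_ : rho \in Num.pos)) ?posrE //.
rewrite -!expRM_natl -expRD ler_expR binE -/l.
have -> : ln rho = - beta by rewrite opprK.
have h1 : 4 * l <= w%:R * beta by rewrite -ler_pdivrMr // mulrAC ltW.
have h2 : 4 / beta * l <= w.+1%:R.
  by apply: le_trans (ltW t2) _; rewrite ler_nat.
have w0 : 0 <= w.+1%:R :> R by [].
have h3 := ler_wpM2l w0 h1.
have h4 := ler_wpM2r (ltW lp) h2.
rewrite expr2; lra.
Qed.

(* From the trivial bounds [omega = k] and [mu = 2 k^2]. *)
Lemma q_norm_trivial (k : nat) (G : graph k) : (0 < k)%N ->
  (q_norm q G <= (2 / Num.sqrt (1 - q) + (1 + 2 * k%:R ^+ 2) / Num.sqrt (1 - q))%:E)%E.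
Proof.
move=> k0; have kp : 0 < (k%:R : R) by rewrite ltr0n.
apply: le_trans (@q_norm_le _ _ G q (2 * k%:R ^+ 2) k hq k0 _ _ _) _.
- by rewrite mulr_ge0 ?sqr_ge0.
- by move=> K _; rewrite -[X in (_ <= X)%N]card_ord max_card.
- move=> x; rewrite centred_form_upper normrM ger0_norm // -mulrA ler_wpM2l //.
  apply: le_trans (upper_form_trivial q01 G x x) _.
  rewrite -expr2 sqr_sqrtr // sumr_ge0 // => i _; exact: sqr_ge0.
rewrite lee_fin -mulrDl ler_wpM2r ?invr_ge0 ?(ltW r0) // mulfK ?gt_eqF //.
by rewrite lerD2l lerD2r; case/andP: q01.
Qed.

(** Insert [mu = 280 sqrt k] and [omega <= C1 ln k] in [q_norm_le]; as [|q| <= sqrt k], the sum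
    [|q| + mu] is at most [281 sqrt k]. *)
Lemma q_norm_tail : exists C c : R, [/\ 0 < C, 0 < c &
  forall k : nat, (2 <= k)%N ->
    er_prob `|q| (fun G : graph k => ~~ (q_norm q G <=
      (2 / Num.sqrt (1 - q) + C * (ln k%:R / Num.sqrt k%:R))%:E)%E) <=
    expR (- c * ln k%:R ^+ 2) + expR (- k%:R)].
Proof.
have [C1 [c [C10 c0 clq]]] := clique_tail.
exists (281 * C1 / Num.sqrt (1 - q)), c; split => //; first by rewrite divr_gt0 // mulr_gt0.
move=> k k2; have k0 : (0 < k)%N by exact: leq_trans k2.
have kp : 0 < (k%:R : R) by rewrite ltr0n.
have s1 : 1 <= Num.sqrt (k%:R : R) by rewrite -[leLHS]sqrtr1 ler_wsqrtr // ler1n.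
have s2 : Num.sqrt (k%:R : R) ^+ 2 = k%:R by rewrite sqr_sqrtr // ltW.
have [w wle hw] := clq k k2.
apply: le_trans (lerD hw (centred_form_prob q01 k0)).
apply: le_trans (er_prob_or q01 _ _); apply: er_prob_mono => // G.
rewrite -negb_and; apply: contra => /andP[/asboolP cl /asboolP ce].
have mu0 : 0 <= 280 * Num.sqrt (k%:R : R) by rewrite mulr_ge0 ?sqrtr_ge0.
apply: le_trans (q_norm_le hq k0 mu0 cl ce) _; rewrite lee_fin.
have -> : 281 * C1 / Num.sqrt (1 - q) * (ln k%:R / Num.sqrt k%:R) =
    281 * Num.sqrt k%:R * (C1 * ln k%:R) / k%:R / Num.sqrt (1 - q).
  by rewrite -[X in _ = _ / X / _]s2; field; rewrite !gt_eqF // (lt_le_trans _ s1).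
rewrite -mulrDl ler_wpM2r ?invr_ge0 ?(ltW r0) // lerD2l.
rewrite ler_wpM2r ?invr_ge0 ?(ltW kp) // ler_pM // ?addr_ge0 //.
by case/andP: q01 => _; lra.
Qed.

End NormTail.

(** * Asymptotic comparisons and the probability bounds *)

Lemma ln_div_sqrt_le (R : realType) (C eps : R) : 0 < C -> 0 < eps ->
  exists K : nat, forall k : nat, (K <= k)%N ->
    C * (ln k%:R / Num.sqrt k%:R) <= eps.
Proof.
(* With [r = k^(1/4)], [ln k = 4 ln r < 4 r], so the left-hand side is at most [4 C / r]; the
   threshold ensures [r >= 4 C / eps]. *)
move=> C0 e0; pose b := (4 * C / eps) ^+ 4; exists (Num.truncn b).+1 => k kK.
have b0 : 0 <= b by rewrite exprn_ge0 // divr_ge0 ?mulr_ge0 // ltW.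
have bk : b <= k%:R.
  case/andP: (truncn_itv b0) => _ /ltW /le_trans; apply; by rewrite ler_nat.
have kp : 0 < (k%:R : R) by rewrite ltr0n (leq_trans _ kK).
pose r := Num.sqrt (Num.sqrt (k%:R : R)).
have rp : 0 < r by rewrite !sqrtr_gt0.
have r2 : Num.sqrt k%:R = r ^+ 2 by rewrite sqr_sqrtr // sqrtr_ge0.
have r4 : k%:R = r ^+ 4 by rewrite (exprM r 2 2) -r2 sqr_sqrtr // ltW.
have br : 4 * C / eps <= r.
  rewrite -(@ler_pXn2r _ 4) ?nnegrE -?r4 //; last exact: ltW.
  by rewrite divr_ge0 ?mulr_ge0 // ltW.
rewrite r2 [in ln _]r4 lnXn // mulrA ler_pdivrMr ?exprn_gt0 //.
have := ln_sublinear rp; rewrite ler_pdivrMr // in br.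
have := ler_wpM2r (ltW rp) br => h1 h2.
have := ler_wpM2l (ltW C0) (ltW h2); rewrite expr2 -mulr_natr; lra.
Qed.

Lemma tail_eventually_le (R : realType) (c eta : R) : 0 < c -> 0 < eta ->
  exists K : nat, forall k : nat, (K <= k)%N ->
    expR (- c * ln k%:R ^+ 2) + expR (- k%:R) <= eta.
Proof.
move=> c0 e0; have small (y : R) : 2 / eta <= y -> expR (- y) <= eta / 2.
  move=> ye; have yp : 0 < y by apply: lt_le_trans ye; rewrite divr_gt0.
  rewrite expRN -[leRHS]invrK lef_pV2 ?posrE ?expR_gt0 ?invr_gt0 ?divr_gt0 //.
  by rewrite invf_div; apply: le_trans ye _; have := expR_ge1Dx y; lra.
(* Chosen so that [c L >= 2 / eta] and, because [L >= 1], [ln k >= L] implies [ln^2 k >= L]. *)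
pose L := 1 + 2 / (c * eta).
have L1 : 1 <= L by rewrite lerDl divr_ge0 // ltW // mulr_gt0.
exists (maxn (Num.truncn (expR L)).+1 (Num.truncn (2 / eta)).+1) => k.
rewrite geq_max => /andP[k1 k2].
have kp : 0 < (k%:R : R) by rewrite ltr0n (leq_trans _ k1).
have h1 : expR L <= k%:R.
  by case/andP: (truncn_itv (expR_ge0 L)) => _ /ltW /le_trans; apply; rewrite ler_nat.
have e2 : 0 <= 2 / eta by rewrite divr_ge0 // ltW.
have h2 : 2 / eta <= k%:R.
  by case/andP: (truncn_itv e2) => _ /ltW /le_trans; apply; rewrite ler_nat.
have Ll : L <= ln k%:R by rewrite -[L]expRK ler_ln ?posrE ?expR_gt0.
rewrite [eta]splitr lerD ?small // mulNr small //.
have LL : L <= ln k%:R ^+ 2.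
  rewrite expr2 -[L]mulr1 ler_pM //; first exact: le_trans L1.
  exact: le_trans Ll.
apply: le_trans (_ : c * L <= _); last by rewrite ler_pM2l.
have -> : c * L = c + 2 / eta by rewrite /L; field; rewrite !gt_eqF.
by rewrite lerDr ltW.
Qed.

Lemma maxe_excess_le (R : realType) (x : \bar R) (a b t : R) :
  0 <= b -> 0 < t -> (x <= (a + b)%:E)%E ->
  (maxe (x - a%:E) 0 * (t^-1)%:E <= (b / t)%:E)%E.
Proof.
move=> b0 t0 xab; rewrite EFinM; apply: lee_wpmul2r.
  by rewrite lee_fin invr_ge0 ltW.
by rewrite ge_max leeBlDr // -EFinD addrC xab lee_fin.
Qed.

Theorem theorem3p11 (R : realType) (q : R) (hq : -1 < q < 1) :
  (forall alpha : R, 2^-1 < alpha < 1 ->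
    exists C c : R, [/\ 0 < C, 0 < c &
      forall k : nat, (1 <= k)%N ->
        1 - expR (- c * ln k%:R ^+ 2)
          - 2 * k%:R * expR (- c * k%:R `^ (2 * alpha - 1))
        <= er_prob `|q| (fun G : graph k =>
             (q_norm q G <=
               (2 / Num.sqrt (1 - q) + C * k%:R `^ (alpha - 1) * ln k%:R)%:E)%E)])
  /\
  (forall eps : R, 0 < eps ->
    exists2 c : R, 0 < c &
      exists K : nat, forall k : nat, (K <= k)%N ->
        1 - expR (- c * ln k%:R ^+ 2)
          - 2 * k%:R * expR (- c * (k%:R / ln k%:R ^+ 2))
        <= er_prob `|q| (fun G : graph k =>
             (q_norm q G <= (2 / Num.sqrt (1 - q) + eps)%:E)%E))
  /\
  (forall eta : R, 0 < eta ->
    exists2 M : R, 0 < M &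
      forall k : nat, (2 <= k)%N ->
        er_prob `|q| (fun G : graph k =>
          (M%:E < maxe (q_norm q G - (2 / Num.sqrt (1 - q))%:E) 0
                    * ((ln k%:R / Num.sqrt k%:R)^-1)%:E)%E)
        <= eta).
Proof.
have [C [c [C0 c0 tail]]] := q_norm_tail hq.
have q01 : 0 <= `|q| <= 1 by rewrite normr_ge0 /= ltW // ltr_norml.
have tail' (a : R) (k : nat) c' : (2 <= k)%N -> c' <= c ->
    2 / Num.sqrt (1 - q) + C * (ln k%:R / Num.sqrt k%:R) <= a ->
    1 - expR (- c' * ln k%:R ^+ 2) - expR (- k%:R) <=
    er_prob `|q| (fun G : graph k => (q_norm q G <= a%:E)%E).
  move=> k2 cc le_a; rewrite er_probC // -addrA -opprD lerD2l lerN2.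
  apply: le_trans (le_trans _ (tail k k2)) _.
    apply: er_prob_mono => // G; apply: contra => /le_trans; apply.
    by rewrite lee_fin.
  by rewrite lerD2r ler_expR ler_wpM2r ?sqr_ge0 // lerN2.
(* One constant for both exponentials: [c' <= c] weakens the clique term, and [c' <= 1] lets
   [exp_le] replace [k] by any smaller [y]. *)
pose c' := Num.min c 1.
have c'0 : 0 < c' by rewrite lt_min c0 ltr01.
have c'c : c' <= c by rewrite ge_min lexx.
have c'1 : c' <= 1 by rewrite ge_min lexx orbT.
have exp_le (k : nat) (y : R) : (1 <= k)%N -> 0 <= y <= k%:R ->
    expR (- k%:R) <= 2 * k%:R * expR (- c' * y).
  move=> k1 /andP[y0 yk]; rewrite -[leLHS]mul1r ler_pM ?expR_ge0 //.
    by have : 1 <= k%:R :> R; [rewrite ler1n | lra].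
  rewrite ler_expR mulNr lerN2; apply: le_trans yk.
  by rewrite -[leRHS]mul1r ler_wpM2r.
split; [|split].
- move=> alpha /andP[al1 al2]; exists C, c'; split=> // k k1.
  (* For [k = 1] the logarithm vanishes and the claimed lower bound is not positive. *)
  have [k2|] := leqP 2 k; last first.
    rewrite ltnS leq_eqVlt ltnNge k1 orbF => /eqP ->.
    apply: le_trans (er_prob_ge0 q01 _).
    rewrite ln1 expr0n mulr0 expR0 subrr sub0r oppr_le0.
    by rewrite !mulr_ge0 ?expR_ge0.
  have k1' : 1 <= (k%:R : R) by rewrite ler1n.
  apply: le_trans (tail' _ k c' k2 c'c _).
    rewrite lerD2l lerN2; apply: exp_le => //; rewrite powR_ge0 /=.
    rewrite -[leRHS]powRr1; last exact: le_trans k1'.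
    by apply: ler_powR => //; lra.
  (* It remains that [k^(-1/2) <= k^(alpha - 1)], which is [alpha > 1/2]. *)
  rewrite lerD2l -mulrA ler_pM2l // mulrC ler_wpM2r ?ln_ge0 //.
  rewrite -powR12_sqrt; last exact: le_trans k1'.
  by rewrite -powRN; apply: ler_powR => //; lra.
- move=> eps eps0; exists c' => //.
  have [K1 hK1] := ln_div_sqrt_le C0 eps0.
  (* Beyond [e] one has [ln k >= 1], so that [k / ln^2 k <= k] as [exp_le] requires. *)
  exists (maxn K1 (maxn 2 (Num.truncn (expR 1 : R)).+1)) => k.
  rewrite !geq_max => /and3P[kK k2 k3].
  have kp : 0 < (k%:R : R) by rewrite ltr0n (leq_trans _ k2).
  have l1 : 1 <= ln (k%:R : R).
    rewrite -[leLHS]expRK ler_ln ?posrE ?expR_gt0 //.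
    by case/andP: (truncn_itv (expR_ge0 (1 : R))) => _ /ltW /le_trans; apply; rewrite ler_nat.
  have l2 : 1 <= ln (k%:R : R) ^+ 2 by rewrite exprn_ege1.
  apply: le_trans (tail' _ k c' k2 c'c _); last by rewrite lerD2l hK1.
  rewrite lerD2l lerN2; apply: exp_le; first exact: leq_trans k2.
  rewrite divr_ge0 ?sqr_ge0 ?(ltW kp) //= ler_pdivrMr; last exact: lt_le_trans l2.
  by rewrite ler_peMr // ltW.
move=> eta eta0; have [K hK] := tail_eventually_le c0 eta0.
have r0 : 0 < Num.sqrt (1 - q) by rewrite sqrtr_gt0 subr_gt0; case/andP: hq.
have l2 : 0 < ln (2 : R) by rewrite ln_gt0 // ltr1n.
pose B := (1 + 2 * K%:R ^+ 2) / Num.sqrt (1 - q).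
have B0 : 0 <= B by rewrite divr_ge0 ?addr_ge0 ?mulr_ge0 ?sqr_ge0 // ltW.
(* [C] serves [k >= K], where the tail is at most [eta]. For [2 <= k < K] the trivial excess is at
   most [B], and dividing by [ln k / sqrt k] costs at most [K / ln 2]. *)
exists (C + B * (K%:R / ln 2)).
  by rewrite ltr_pwDl // mulr_ge0 // divr_ge0 // ltW.
move=> k k2; have k1 : (1 <= k)%N by exact: leq_trans k2.
have kp : 0 < (k%:R : R) by rewrite ltr0n.
have lk : ln 2 <= ln (k%:R : R) by rewrite ler_ln ?posrE // ler_nat.
have lkp : 0 < ln (k%:R : R) by exact: lt_le_trans lk.
have t0 : 0 < ln (k%:R : R) / Num.sqrt k%:R by rewrite divr_gt0 ?sqrtr_gt0.
have [Kk|kK] := leqP K k.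
  apply: le_trans (hK _ Kk); apply: le_trans (tail k k2).
  apply: er_prob_mono => // G; apply: contraTN => good; rewrite -leNgt.
  apply: le_trans (maxe_excess_le _ t0 good) _.
    by rewrite mulr_ge0 // ltW.
  by rewrite lee_fin mulfK ?gt_eqF // lerDl mulr_ge0 // divr_ge0 // ltW.
(* For these [k] the event is empty. *)
apply: le_trans (ltW eta0); rewrite /er_prob big_pred0 // => G.
apply/negbTE; rewrite -leNgt.
apply: le_trans (maxe_excess_le _ t0 (q_norm_trivial hq G k1)) _.
  by rewrite divr_ge0 ?addr_ge0 ?mulr_ge0 ?sqr_ge0 // ltW.
rewrite lee_fin; apply: ler_wpDl; first exact: ltW.
apply: ler_pM.
- by rewrite divr_ge0 ?addr_ge0 ?mulr_ge0 ?sqr_ge0 // ltW.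
- by rewrite invr_ge0 ltW.
- rewrite ler_wpM2r ?invr_ge0 ?(ltW r0) // lerD2l ler_wpM2l //.
  by rewrite lerXn2r ?nnegrE // ler_nat ltnW.
rewrite invf_div ler_pM ?sqrtr_ge0 ?invr_ge0 ?(ltW lkp) //; last by rewrite lef_pV2 ?posrE.
apply: le_trans (_ : k%:R <= _); last by rewrite ler_nat ltnW.
rewrite -[leRHS]ger0_norm ?(ltW kp) // -sqrtr_sqr ler_wsqrtr // -natrX ler_nat.
by rewrite leq_pmulr.
Qed.
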